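(* Let $K$ be a number field with ring of integers $R$. Let $n\geq1$ be an integer, $p$ a prime number and $q=p^m$ with $m\ge1$. Assume that $K$ contains a primitive $p$th root of unity. There exists a twist $J$ for the group algebra $K\,\mathrm{PSL}_{2n+1}(q)$, arising from a $2$-cocycle on an abelian subgroup, such that $(K\,\mathrm{PSL}_{2n+1}(q))_J$ does not admit a Hopf order over $R$.
   Context: Hopf orders. Let $H$ be a finite-dimensional Hopf algebra over a field $K$ and $R$ a subring of $K$. A Hopf order of $H$ over $R$ is a finitely generated projective $R$-submodule $X$ of $H$ such that the natural map $X\otimes_R K\to H$ is an isomorphism and $1_H\in X$, $XX\subseteq X$, $\Delta(X)\subseteq X\otimes_R X$ (viewed inside $H\otimes_K H$), $\varepsilon(X)\subseteq R$, $S(X)\subseteq X$, where $\Delta,\varepsilon,S$ are the coproduct, counit and antipode of $H$. Twists. Let $G$ be a finite group and $M$ an abelian subgroup such that $KM$ splits as an algebra. Let $\widehat{M}$ be the group of characters $M\to K^\times$ and, for $\phi\in\widehat{M}$, $e_\phi=\frac1{|M|}\sum_{m\in M}\phi(m^{-1})m$. A twist of $KG$ arising from a $2$-cocycle on the abelian subgroup $M$ is an element $J=\sum_{\phi,\psi\in\widehat{M}}\omega(\phi,\psi)e_\phi\otimes e_\psi$, where $\omega:\widehat{M}\times\widehat{M}\to K^\times$ is a normalized $2$-cocycle. The Hopf algebra $(KG)_J$ equals $KG$ as an algebra, with the same counit, coproduct $\Delta_J(h)=J\Delta(h)J^{-1}$ and antipode $S_J(h)=U_JS(h)U_J^{-1}$,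 where $U_J=\sum_\phi\omega(\phi,\phi^{-1})e_\phi$. $\mathrm{PSL}_{2n+1}(q)$ is the projective special linear group over the field $\mathbb{F}_q$ with $q$ elements. *)

(* Defs.v *)
From HB Require Import structures.
From mathcomp Require Import all_boot all_order all_algebra all_fingroup.
From mathcomp Require Import all_solvable all_field.
From mathcomp Require Import boolp classical_sets fsbigop.

Set Implicit Arguments.
Unset Strict Implicit.
Unset Printing Implicit Defensive.

Import GRing.Theory.
Local Open Scope ring_scope.

Definition is_tensor (R : comNzRingType) (U V T : lmodType R)
    (t : {bilinear U -> V -> T}) : Prop :=
  forall (W : lmodType R) (b : {bilinear U -> V -> W}),
    exists2 f : {linear T -> W}, (forall u v, f (t u v) = b u v)
      & forall g : {linear T -> W}, (forall u v, g (t u v) = b u v) -> g =1 f.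

Definition finitely_generated (R : nzRingType) (P : lmodType R) : Prop :=
  exists n (x : 'I_n -> P), forall y, exists r : 'I_n -> R,
    y = \sum_i r i *: x i.

Definition projective (R : nzRingType) (P : lmodType R) : Prop :=
  forall (M N : lmodType R) (f : {linear M -> N}) (g : {linear P -> N}),
    (forall y, exists x, f x = y) ->
    exists h : {linear P -> M}, forall p, f (h p) = g p.

Definition restrict_scalars (K : fieldType) (R : subringClosed K)
  (V : lmodType K) : Type := V.

Section Subring.
Variables (K : fieldType) (R : subringClosed K).

Definition subring : Type := {x : K | x \in R}.
HB.instance Definition _ := SubType.on subring.
HB.instance Definition _ := Choice.on subring.
HB.instance Definition _ := [SubChoice_isSubComNzRing of subring by <:].

Section Restrict.
Variable V : lmodType K.
HB.instance Definition _ := GRing.Zmodule.on (restrict_scalars R V).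

Definition restrict_scale (r : subring) (v : restrict_scalars R V) :
  restrict_scalars R V := (val r : K) *: (v : V).

Fact restrict_scaleA a b v :
  restrict_scale a (restrict_scale b v) = restrict_scale (a * b) v.
Proof. by rewrite /restrict_scale scalerA. Qed.
Fact restrict_scale1 : left_id 1 restrict_scale.
Proof. by move=> v; rewrite /restrict_scale scale1r. Qed.
Fact restrict_scaleDr : right_distributive restrict_scale +%R.
Proof. by move=> a u v; rewrite /restrict_scale scalerDr. Qed.
Fact restrict_scaleDl v : {morph restrict_scale^~ v : a b / a + b}.
Proof. by move=> a b; rewrite /restrict_scale scalerDl. Qed.

HB.instance Definition _ := GRing.Zmodule_isLmodule.Build subring
  (restrict_scalars R V) restrict_scaleA restrict_scale1 restrict_scaleDr
  restrict_scaleDl.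
End Restrict.

Section Submodule.
Variables (V : lmodType K) (X : submodClosed (restrict_scalars R V)).

Definition submodule : Type := {v : restrict_scalars R V | v \in X}.
HB.instance Definition _ := SubType.on submodule.
HB.instance Definition _ := Choice.on submodule.
HB.instance Definition _ := [SubChoice_isSubLmodule of submodule by <:].

(** The map [X * K -> V] inducing the natural map from [X (x)_R K] to [V]; the
    latter is an isomorphism exactly when [V], with this map, is a tensor
    product of [X] and [K] over [R]. *)
Definition extension_map (x : submodule) (k : restrict_scalars R K^o) :
  restrict_scalars R V := (k : K) *: (val x : V).

Fact extension_map_bilinear :
  bilinear_for *:%R *:%R extension_map.
Proof.
split=> [k r x y | x r k l]; rewrite /extension_map.
  transitivity
    ((k : K) *: ((val r : K) *: (val x : V) + (val y : V))) => //.
  by rewrite scalerDr scalerA mulrC -scalerA.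
transitivity (((val r : K) * (k : K) + (l : K)) *: (val x : V)) => //.
by rewrite scalerDl -scalerA.
Qed.
HB.instance Definition _ :=
  bilinear_isBilinear.Build subring submodule (restrict_scalars R K^o)
    (restrict_scalars R V) *:%R *:%R extension_map extension_map_bilinear.
End Submodule.
End Subring.

(** The underlying data of a finite-dimensional Hopf algebra; [htens], the map
    sending [(a, b)] to [a (x) b], makes [hsquare] a tensor square of the
    carrier. *)
Record hopf_data (K : fieldType) := HopfData {
  hcarrier :> falgType K;
  hsquare : lmodType K;
  htens : {bilinear hcarrier -> hcarrier -> hsquare};
  htensP : is_tensor htens;
  comul : hcarrier -> hsquare;
  counit : hcarrier -> K;
  antipode : hcarrier -> hcarrier }.

(** The image in [hsquare H] of the tensor square over a subring of a subset
    [X] stable under that subring. *)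
Definition tensor_image (K : fieldType) (H : hopf_data K) (X : {pred H})
    (t : hsquare H) : Prop :=
  exists n (x y : 'I_n -> H),
    [/\ forall i, x i \in X, forall i, y i \in X
       & t = \sum_i htens H (x i) (y i)].

Definition is_hopf_order (K : fieldType) (R : subringClosed K)
    (H : hopf_data K) (X : submodClosed (restrict_scalars R H)) : Prop :=
  [/\ finitely_generated (submodule X) /\ projective (submodule X),
      is_tensor (@extension_map K R H X : {bilinear _ -> _ -> _}),
      (1 : H) \in X /\ (forall a b : H, a \in X -> b \in X -> a * b \in X),
      forall a : H, a \in X -> tensor_image [pred x : H | x \in X] (comul a)
    & (forall a : H, a \in X -> counit a \in R) /\
      (forall a : H, a \in X -> antipode a \in X)].

Definition admits_hopf_order (K : fieldType) (R : subringClosed K)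
    (H : hopf_data K) : Prop :=
  exists X : submodClosed (restrict_scalars R H), is_hopf_order X.

Section GroupAlgebra.
Variable K : fieldType.

Definition group_algebra (G : finGroupType) : Type := {ffun G -> K^o}.

Section Ring.
Variable G : finGroupType.
HB.instance Definition _ :=
  Vector.copy (group_algebra G) {ffun G -> K^o}.
Implicit Types a b c : group_algebra G.

Definition gelt (g : G) : group_algebra G := [ffun x => (x == g)%:R].

Definition gmul a b : group_algebra G :=
  [ffun x => \sum_y (a y : K) * b (y^-1 * x)%g].

Fact gmulA : associative gmul.
Proof.
move=> a b c; apply/ffunP=> x; rewrite !ffunE.
under eq_bigr do rewrite ffunE mulr_sumr.
under [RHS]eq_bigr do rewrite ffunE mulr_suml.
rewrite [RHS]exchange_big /=; apply: eq_bigr => z _.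
rewrite [RHS](reindex_inj (mulgI z)) /=; apply: eq_bigr => y _.
by rewrite mulKg invMg -mulgA mulrA.
Qed.
Fact gmul1g : left_id (gelt 1) gmul.
Proof.
move=> a; apply/ffunP=> x; rewrite !ffunE (bigD1 1%g) //= ffunE eqxx mul1r.
rewrite invg1 mul1g big1 ?addr0 // => y /negbTE yn1.
by rewrite ffunE yn1 mul0r.
Qed.
Fact gmulg1 : right_id (gelt 1) gmul.
Proof.
move=> a; apply/ffunP=> x; rewrite !ffunE (bigD1 x) //= ffunE mulVg eqxx mulr1.
rewrite big1 ?addr0 // => y yx.
by rewrite ffunE -eq_mulVg1 (negbTE yx) mulr0.
Qed.
Fact gmulDl : left_distributive gmul +%R.
Proof.
move=> a b c; apply/ffunP=> x; rewrite !ffunE -big_split /=.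
by apply: eq_bigr => y _; rewrite ffunE mulrDl.
Qed.
Fact gmulDr : right_distributive gmul +%R.
Proof.
move=> a b c; apply/ffunP=> x; rewrite !ffunE -big_split /=.
by apply: eq_bigr => y _; rewrite ffunE mulrDr.
Qed.
Fact gelt1_neq0 : gelt 1 != 0.
Proof.
by apply/eqP=> /ffunP/(_ 1%g)/eqP; rewrite !ffunE eqxx oner_eq0.
Qed.
HB.instance Definition _ := GRing.Zmodule_isNzRing.Build (group_algebra G)
  gmulA gmul1g gmulg1 gmulDl gmulDr gelt1_neq0.

Fact gscaleAl k a b : k *: (a * b) = (k *: a) * b.
Proof.
apply/ffunP=> x; rewrite !ffunE [LHS]mulr_sumr.
by apply: eq_bigr => y _; rewrite ffunE mulrA.
Qed.
HB.instance Definition _ :=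
  GRing.Lmodule_isLalgebra.Build K (group_algebra G) gscaleAl.
Fact gscaleAr k a b : k *: (a * b) = a * (k *: b).
Proof.
apply/ffunP=> x; rewrite !ffunE [LHS]mulr_sumr.
by apply: eq_bigr => y _; rewrite ffunE mulrCA.
Qed.
HB.instance Definition _ :=
  GRing.Lalgebra_isAlgebra.Build K (group_algebra G) gscaleAr.
HB.instance Definition _ := Algebra_isFalgebra.Build K (group_algebra G).

Lemma group_algebra_sum a : a = \sum_g (a g : K) *: gelt g.
Proof.
apply/ffunP=> x; rewrite sum_ffunE (bigD1 x) //= !ffunE eqxx [_ *: _]mulr1.
rewrite big1 ?addr0 // => y yx.
by rewrite !ffunE eq_sym (negbTE yx) scaler0.
Qed.

Lemma geltM g h : gelt g * gelt h = gelt (g * h)%g.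
Proof.
apply/ffunP=> x; rewrite !ffunE (bigD1 g) //= !ffunE eqxx mul1r.
rewrite big1 ?addr0 => [|y /negbTE yg]; last by rewrite ffunE yg mul0r.
by rewrite (can2_eq (mulKVg g) (mulKg g)).
Qed.
End Ring.

(** [K[G * G]], with [g (x) h] the pair [(g, h)], as the tensor square of
    [K[G]]. *)
Section Tensor.
Variable G : finGroupType.

Definition gtens (a b : group_algebra G) : group_algebra (G * G)%type :=
  [ffun p => (a p.1 : K) * b p.2].

Fact gtens_bilinear : bilinear_for *:%R *:%R gtens.
Proof.
split=> [b k a c | a k b c]; apply/ffunP=> p; rewrite !ffunE.
  by rewrite mulrDl; congr (_ + _); apply: esym (mulrA _ _ _).
by rewrite mulrDr; congr (_ + _); apply: mulrCA.
Qed.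
HB.instance Definition _ :=
  bilinear_isBilinear.Build K (group_algebra G) (group_algebra G)
    (group_algebra (G * G)%type) *:%R *:%R gtens gtens_bilinear.

Lemma gtens_gelt g h : gtens (gelt g) (gelt h) = gelt (g, h).
Proof. by apply/ffunP=> p; rewrite !ffunE -natrM mulnb. Qed.

Lemma gtensP : is_tensor (gtens : {bilinear _ -> _ -> _}).
Proof.
move=> W b.
pose f (t : group_algebra (G * G)%type) : W :=
  \sum_p (t p : K) *: b (gelt p.1) (gelt p.2).
have flin : linear f.
  move=> k s t; rewrite /f scaler_sumr -big_split /=; apply: eq_bigr => p _.
  by rewrite !ffunE scalerDl scalerA.
pose fM := GRing.isLinear.Build _ _ _ _ f flin.
pose fL : {linear group_algebra (G * G)%type -> W} := HB.pack f fM.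
exists fL => [u v | g gE t].
  rewrite [u in RHS]group_algebra_sum [v in RHS]group_algebra_sum.
  rewrite linear_sumlz /= /f.
  under [RHS]eq_bigr do rewrite linear_sumr.
  rewrite pair_bigA /=; apply: eq_bigr => -[x y] _ /=.
  by rewrite linearZl_LR linearZr_LR /= scalerA ffunE.
rewrite [t in LHS]group_algebra_sum linear_sum /= /f.
by apply: eq_bigr => -[x y] _; rewrite linearZ -gtens_gelt gE.
Qed.
End Tensor.
End GroupAlgebra.

Section HopfGroupAlgebra.
Variables (K : fieldType) (G : finGroupType).
Implicit Type a : group_algebra K G.

Definition gcomul a : group_algebra K (G * G)%type :=
  \sum_g (a g : K) *: gtens (gelt K g) (gelt K g).
Definition gcounit a : K := \sum_g (a g : K).
Definition gantipode a : group_algebra K G :=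
  \sum_g (a g : K) *: gelt K g^-1%g.
End HopfGroupAlgebra.

Definition split_algebra (K : fieldType) (A : falgType K) : Prop :=
  exists n (f : {linear A -> {ffun 'I_n -> K^o}}),
    [/\ f 1 = 1, forall a b, f (a * b) = f a * f b & bijective f].

Section Characters.
Variables (K : fieldType) (M : finGroupType).

Definition is_char (chi : {ffun M -> K}) : bool :=
  [forall x, chi x != 0] && [forall x, forall y, chi (x * y)%g == chi x * chi y].

Definition chargroup : Type := {chi : {ffun M -> K} | is_char chi}.
HB.instance Definition _ := SubType.on chargroup.
HB.instance Definition _ := Choice.on chargroup.

Definition char_val (chi : chargroup) (x : M) : K := val chi x.

Fact is_charP (chi : {ffun M -> K}) :
  reflect ((forall x, chi x != 0) /\
           (forall x y, chi (x * y)%g = chi x * chi y)) (is_char chi).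
Proof.
apply: (iffP andP) => -[/= c0 cM]; split.
- exact/forallP.
- by move=> x y; apply/eqP; move/forallP/(_ x)/forallP: cM; apply.
- exact/forallP.
by apply/forallP=> x; apply/forallP=> y; rewrite cM.
Qed.

Fact char1_subproof : is_char [ffun=> 1].
Proof.
by apply/is_charP; split=> [x|x y]; rewrite !ffunE ?oner_eq0 ?mulr1.
Qed.
Fact charM_subproof (f g : chargroup) : is_char [ffun x => val f x * val g x].
Proof.
case/is_charP: (valP f) => f0 fM; case/is_charP: (valP g) => g0 gM.
apply/is_charP; split=> [x|x y]; rewrite !ffunE ?mulf_neq0 //.
by rewrite fM gM mulrACA.
Qed.
Fact charV_subproof (f : chargroup) : is_char [ffun x => (val f x)^-1].
Proof.
case/is_charP: (valP f) => f0 fM.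
apply/is_charP; split=> [x|x y]; rewrite !ffunE ?invr_eq0 //.
by rewrite fM invfM.
Qed.

Definition char1 : chargroup := Sub _ char1_subproof.
Definition charM f g : chargroup := Sub _ (charM_subproof f g).
Definition charV f : chargroup := Sub _ (charV_subproof f).

Fact charMA : associative charM.
Proof. by move=> f g h; apply/val_inj/ffunP=> x; rewrite !ffunE mulrA. Qed.
Fact charM1l : left_id char1 charM.
Proof. by move=> f; apply/val_inj/ffunP=> x; rewrite !ffunE mul1r. Qed.
Fact charM1r : right_id char1 charM.
Proof. by move=> f; apply/val_inj/ffunP=> x; rewrite !ffunE mulr1. Qed.
Fact charMVl : left_inverse char1 charV charM.
Proof.
move=> f; apply/val_inj/ffunP=> x; rewrite !ffunE mulVf //.
by case/is_charP: (valP f).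
Qed.
Fact charMVr : right_inverse char1 charV charM.
Proof.
move=> f; apply/val_inj/ffunP=> x; rewrite !ffunE mulfV //.
by case/is_charP: (valP f).
Qed.
HB.instance Definition _ :=
  isGroup.Build chargroup charMA charM1l charM1r charMVl charMVr.

Definition normalized_2cocycle (w : chargroup -> chargroup -> K) : Prop :=
  [/\ forall f g, w f g != 0,
      forall f, w 1%g f = 1 /\ w f 1%g = 1
    & forall f g h, w f g * w (f * g)%g h = w g h * w f (g * h)%g].
End Characters.

Section Twist.
Variables (K : fieldType) (G : finGroupType) (M : {group G}).
Local Notation Mhat := (chargroup K (subg_of M)).

Definition char_idem (f : Mhat) : group_algebra K G :=
  (#|M|%:R)^-1 *: \sum_(m : subg_of M) char_val f m^-1%g *: gelt K (sgval m).

Variable w : Mhat -> Mhat -> K.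

Definition twist : group_algebra K (G * G)%type :=
  \sum_(f \in [set: Mhat]%classic) \sum_(g \in [set: Mhat]%classic)
    w f g *: gtens (char_idem f) (char_idem g).

Definition twist_unit : group_algebra K G :=
  \sum_(f \in [set: Mhat]%classic) w f f^-1%g *: char_idem f.

(** The inverses are those of the rings [K[G * G]] and [K[G]]; they are genuine
    inverses when [M] is abelian, [K[M]] is split and [w] is a normalized
    2-cocycle. *)
Definition twisted_comul (a : group_algebra K G) :
    group_algebra K (G * G)%type :=
  twist * gcomul a * twist^-1.

Definition twisted_antipode (a : group_algebra K G) : group_algebra K G :=
  twist_unit * gantipode a * twist_unit^-1.

Definition twisted_group_algebra : hopf_data K :=
  HopfData (@gtensP K G) twisted_comul (@gcounit K G) twisted_antipode.
End Twist.

Section Integers.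
Variable K : fieldExtType rat.

Definition ring_of_integers : {pred K} :=
  fun x => `[< integralOver (intr : int -> K) x >].

Fact ring_of_integers_subring : subring_closed ring_of_integers.
Proof.
split=> [|x y /asboolP xi /asboolP yi|x y /asboolP xi /asboolP yi]; apply/asboolP.
- exact: integral1.
- exact: integral_sub.
- exact: integral_mul.
Qed.
HB.instance Definition _ :=
  GRing.isSubringClosed.Build K ring_of_integers ring_of_integers_subring.
End Integers.
Arguments ring_of_integers : clear implicits.

Section PSL.
Variables (n : nat) (F : finFieldType).
Local Open Scope group_scope.

Definition SL : {set {'GL_n[F]}} := [set A | (\det (GLval A) == 1)%R].

Fact SL_group_set : group_set SL.
Proof.
apply/group_setP; split=> [|A B]; first by rewrite inE GL_1E det1.
by rewrite !inE GL_ME det_mulmx => /eqP-> /eqP->; rewrite mulr1.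
Qed.
Canonical SL_group := Group SL_group_set.

(** A type, so that the group algebra of [PSL] is [group_algebra K PSL]. *)
Definition PSL : finGroupType := subg_of (SL_group / 'Z(SL_group))%G.
End PSL.

(* Main.v *)
Require Import Defs.
From HB Require Import structures.
From mathcomp Require Import boolp classical_sets fsbigop.
From mathcomp Require Import all_boot all_order all_algebra all_fingroup.
From mathcomp Require Import all_solvable all_field.
From mathcomp Require Import ring.

(** Let [X] be a Hopf order of the twisted algebra [H], let [M = (Z/p)^2] with
    idempotents [e_phi], and let [e] be the idempotent of the trivial character.
    Characters of [H] are integral on [X] and, dually, cocharacters lie in [X].
    Since the bicharacter on the dual of [M] is nondegenerate, the elements
    [e_phi g e_psi] are combinations of the coefficients of a comodule of
    dimension [p^2] whose cocharacter is [c_g = p^2 e g e]. So [c_g] and [c_h]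
    lie in [X], and [Z = Delta_J(c_g) (1 (x) c_h)] lies in [X (x) X]. For class
    functions [F], [F'] of a subgroup [L] containing [M], [g] and [h], the
    factor [e] of [c_h] kills all but one term of [Delta_J(c_g)], and
    [(F (x) F')(Z) = p^-2 (sum_m F(m g)) (sum_(m, m') F'(m g m' h))].
    Take for [L] the image of [SL_3(F_p)], for [M] the transvections with
    centre [e0], for [F = F'] the number of [z] in [GL_3(F_p)] conjugating a
    fixed matrix with irreducible characteristic polynomial [P] to the argument,
    and [g = h] a cyclic permutation matrix. As [u] runs over [M], [u y] has
    characteristic polynomial [P] exactly once if [e0] is a cyclic vector of
    [y], and never otherwise. The value obtained is
    [p^-2 (p^3 - 1)^2 (p^2 - p + 1)], which is not an algebraic integer. *)

Set Implicit Arguments.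
Unset Strict Implicit.
Unset Printing Implicit Defensive.

Import GRing.Theory.
Local Open Scope ring_scope.

(** * Integrality in a number field, tested through an embedding into the algebraic numbers *)

Section NumberField.
Variable K : fieldExtType rat.

(** A primitive element [z] goes to a root in [algC] of its minimal polynomial over the rationals.
    Every [y] is a rational polynomial in [z], and its image is that polynomial evaluated at the
    chosen root. *)
Lemma number_field_embedding : exists f : {rmorphism K -> algC}, True.
Proof.
have [z fullz] : exists z : K, (<<1; z>> = fullv)%VS.
  exists (separable_generator 1 {:K}).
  rewrite -eq_adjoin_separable_generator ?sub1v //.
  by apply/separableP=> y _; apply: pcharf0_separable => q;
    rewrite (fmorph_pchar (in_alg K)) Num.Theory.pchar_num.
have [/polyOver1P[r Dr] rz0] := (minPolyOver 1 z, root_minPoly 1 z).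
have [x /eqP rx0] : exists x : algC, (map_poly ratr r).[x] == 0.
  have [|x rx] := closed_rootP (map_poly (ratr : rat -> algC) r) _.
    rewrite size_map_poly -(size_map_poly (in_alg K)) -Dr size_minPoly.
    by rewrite /adjoin_degree.
  by exists x; rewrite -/(root _ _).
have /all_sig[q Dq] (y : K) : {q : {poly rat} | (map_poly (in_alg K) q).[z] =
  y}.
  apply: sig_eqW; have: y \in <<1; z>>%VS by rewrite fullz memvf.
  by case/Fadjoin_polyP=> _ /polyOver1P[q ->] ->; exists q.
(* The choice of [q y] is arbitrary. Two choices differ by a multiple of the minimal polynomial, so
   the value at [x] does not depend on it; the ring laws below follow from this. *)
have eq_ev (q1 q2 : {poly rat}) :
  (map_poly (in_alg K) q1).[z] = (map_poly (in_alg K) q2).[z] ->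
  (map_poly ratr q1).[x] = (map_poly ratr q2).[x].
- move=> /eqP; rewrite -subr_eq0 -hornerN -hornerD -rmorphN -rmorphD /= => q0.
  have: r %| q1 - q2.
    rewrite -(dvdp_map (in_alg K)) /= -Dr minPoly_dvdp //.
    by apply/polyOver1P; exists (q1 - q2).
  case/dvdpP=> s Ds; apply/eqP; rewrite -subr_eq0 -hornerN -hornerD -!rmorphN.
  by rewrite -!rmorphD /= Ds rmorphM hornerM rx0 mulr0.
pose f y := (map_poly ratr (q y)).[x].
have fa : zmod_morphism f.
  move=> a b; rewrite /f -hornerN -hornerD -rmorphN -rmorphD; apply: eq_ev.
  by rewrite rmorphD rmorphN hornerD hornerN !Dq.
have fm : monoid_morphism f.
  split=> [|a b]; rewrite /f.
    by rewrite (eq_ev _ 1) rmorph1 hornerC // Dq.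
  rewrite -hornerM -rmorphM; apply: eq_ev.
  by rewrite rmorphM hornerM !Dq.
pose faM := GRing.isZmodMorphism.Build _ _ f fa.
pose fmM := GRing.isMonoidMorphism.Build _ _ f fm.
by exists (HB.pack f faM fmM : {rmorphism K -> algC}).
Qed.

Lemma integral_embedding (f : {rmorphism K -> algC}) (x : K) :
  x \in ring_of_integers K <-> integralOver (intr : int -> algC) (f x).
Proof.
have fZ p : map_poly (intr : int -> algC) p = map_poly f (map_poly intr p).
  by rewrite -map_poly_comp; apply: eq_map_poly => a /=; rewrite rmorph_int.
split=> [/asboolP[p mp px]|[p mp px]]; last apply/asboolP; exists p => //.
  by rewrite fZ fmorph_root.
by move: px; rewrite fZ fmorph_root.
Qed.

(** The eigenvalues of [A] in [algC] are roots of its minimal polynomial, hence of [p], hence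
    algebraic integers. The trace is their sum, read off the subleading coefficient of the
    characteristic polynomial. *)
Lemma integral_mxtrace n (A : 'M[K]_n.+1) (p : {poly K}) :
  p \is monic -> p \is a polyOver (ring_of_integers K) -> horner_mx A p = 0 ->
  \tr A \in ring_of_integers K.
Proof.
move=> mp pR pA0; have [f _] := number_field_embedding.
have int_root x : root (map_poly f p) x -> integralOver (intr : int -> algC) x.
  move/integral_root_monic; apply; first by rewrite map_monic.
  apply/integral_poly=> i; rewrite coef_map.
  exact/integral_embedding/(polyOverP pR).
have [rs Drs] := closed_field_poly_normal (map_poly f (char_poly A)).
have mon_cp := char_poly_monic A.
have lead1 : lead_coef (map_poly f (char_poly A)) = 1.
  by apply/monicP; rewrite map_monic.
move: Drs; rewrite lead1 scale1r => Drs.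
have sz_rs : size rs = n.+1.
  apply/eq_add_S; rewrite -(size_char_poly A) -(size_map_poly f) Drs.
  by rewrite size_prod_XsubC.
have rs_int x : x \in rs -> integralOver (intr : int -> algC) x.
  rewrite -root_prod_XsubC -Drs map_char_poly -root_mxminpoly => rx.
  apply: int_root; apply: root_dvdp rx; apply: mxminpoly_min.
  by rewrite -map_horner_mx pA0 map_mx0.
apply/(integral_embedding f).
have := char_poly_trace A (ltn0Sn n); move/(congr1 f); rewrite -coef_map Drs.
have -> : n.+1.-1 = (size rs).-1 by rewrite sz_rs.
rewrite coefPn_prod_XsubC ?sz_rs // rmorphN.
move=> /oppr_inj <-; rewrite big_seq.
apply: (big_ind (integralOver intr)) => //.
- exact: integral0.
- exact: integral_add.
Qed.

(** A rational algebraic integer is an integer. This converts integrality into divisibility of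
    natural numbers. *)
Lemma dvdn_integral (N d : nat) : (0 < d)%N ->
  (N%:R / d%:R : K) \in ring_of_integers K -> (d %| N)%N.
Proof.
move=> d_gt0; have [f _] := number_field_embedding.
move/(integral_embedding f) => [p mp px].
have: f (N%:R / d%:R) \in Num.int.
  apply: Cint_rat_Aint.
    by rewrite fmorph_div !rmorph_nat rpred_div ?rpred_nat.
  apply: root_monic_Aint px _ _; first exact: monic_map.
  by apply/polyOverP=> i; rewrite coef_map Num.Theory.intr_int.
rewrite fmorph_div !rmorph_nat => /Num.Theory.intrP[m /eqP].
have d0 : d%:R != 0 :> algC by rewrite Num.Theory.pnatr_eq0 -lt0n.
rewrite (can2_eq (divfK d0) (mulfK d0)) -[d%:R]/((d%:Z)%:~R)
  -[N%:R]/((N%:Z)%:~R).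
rewrite -intrM eqr_int => /eqP/(congr1 absz); rewrite abszM /= => ->.
exact: dvdn_mull.
Qed.

Lemma prime_natr_neq0 (p : nat) : prime p -> p%:R != 0 :> K.
Proof.
move=> p_prime; rewrite -(rmorph_nat (in_alg K)) fmorph_eq0.
by rewrite Num.Theory.pnatr_eq0 -lt0n prime_gt0.
Qed.
End NumberField.

(** * Traces of operators preserving a lattice *)

Section IntegralTrace.
Variables (K : fieldExtType rat) (V : lmodType K) (T : {linear V -> V}).

Definition poly_action (p : {poly K}) (x : V) : V :=
  \sum_(i < size p) p`_i *: iter i T x.

Lemma poly_action_sum p I (r : seq I) (P : pred I) (a : I -> K) (x : I -> V) :
  poly_action p (\sum_(i <- r | P i) a i *: x i) =
  \sum_(i <- r | P i) a i *: poly_action p (x i).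
Proof.
rewrite /poly_action; under [RHS]eq_bigr do rewrite scaler_sumr.
rewrite exchange_big /=; apply: eq_bigr => k _.
have -> m : iter m T (\sum_(i <- r | P i) a i *: x i) =
            \sum_(i <- r | P i) a i *: iter m T (x i).
  elim: m => //= m ->; rewrite linear_sum.
  by apply: eq_bigr => i _; rewrite linearZ.
by rewrite scaler_sumr; apply: eq_bigr => i _; rewrite !scalerA mulrC.
Qed.

(** Powers of [T] act on the family through powers of [B], by induction. It serves both for the
    generators [v] of the lattice, which may be dependent, and for the families [c i]. *)
Lemma poly_action_mx p n (B : 'M[K]_n.+1) (u : 'I_n.+1 -> V) :
  (forall i, T (u i) = \sum_j B i j *: u j) ->
  forall i, poly_action p (u i) = \sum_j horner_mx B p i j *: u j.
Proof.
move=> TuE; have iterE m k : iter m T (u k) = \sum_j (B ^+ m) k j *: u j.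
  elim: m k => [|m IHm] k /=.
    rewrite expr0 (bigD1 k) //= big1 => [|j jk];
      first by rewrite mxE eqxx scale1r addr0.
    by rewrite mxE eq_sym (negbTE jk) scale0r.
  rewrite IHm linear_sum; transitivity (\sum_i \sum_j (B ^+ m) k i *: (B i j *:
    u j)).
    by apply: eq_bigr => l _; rewrite linearZ -scaler_sumr -TuE.
  rewrite exchange_big /=; apply: eq_bigr => j _;
    rewrite exprSr mxE scaler_suml.
  by apply: eq_bigr => l _; rewrite scalerA.
move=> i; rewrite /poly_action; under eq_bigr do rewrite iterE scaler_sumr.
rewrite exchange_big /=; apply: eq_bigr => j _.
rewrite -[in RHS](coefK p) poly_def rmorph_sum /= summxE scaler_suml.
apply: eq_bigr => k _; rewrite horner_mxZ rmorphXn /= horner_mx_X mxE scalerA.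
by [].
Qed.

Lemma char_poly_polyOver n (R : subringClosed K) (B : 'M[K]_n) :
  (forall i j, B i j \in R) -> char_poly B \is a polyOver R.
Proof.
move=> BR; apply: rpred_sum => s _; rewrite rpredMsign.
apply: rpred_prod => j _; rewrite !mxE rpredB ?polyOverC //.
by rewrite rpredMn ?polyOverX.
Qed.

(** Let [p] be the characteristic polynomial of the integral matrix by which [T] acts on the [v i].
    By Cayley-Hamilton [p(T)] kills these vectors, hence every [c i j]; joint freeness turns this
    into [p(A) = 0], and [integral_mxtrace] applies. *)
Lemma integral_trace_ord N (v : 'I_N -> V) (I : Type) (J : finType) (c : I -> J
  -> V)
    (A : J -> J -> K) :
    (forall i, exists2 r : 'I_N -> K, (forall j, r j \in ring_of_integers K)
                             & T (v i) = \sum_j r j *: v j) ->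
    (forall i j, exists k : 'I_N -> K, c i j = \sum_l k l *: v l) ->
    (forall i j, T (c i j) = \sum_k A j k *: c i k) ->
    (forall b : J -> K, (forall i, \sum_j b j *: c i j = 0) -> forall j,
      b j = 0) ->
  \sum_j A j j \in ring_of_integers K.
Proof.
move=> /fin_all_exists2[r rR Tv] cv Tc free_c.
case: (posnP #|J|) => [/card0_eq J0|].
  by rewrite big_pred0 ?rpred0.
case cardJ: #|J| => [//|n] _.
pose e (i : 'I_n.+1) : J := enum_val (cast_ord (esym cardJ) i).
have e_bij : bijective e.
  exists (fun j => cast_ord cardJ (enum_rank j)) => x; rewrite /e.
    by rewrite enum_valK cast_ordKV.
  by rewrite cast_ordK enum_rankK.
have sumE (W : nmodType) (F : J -> W) : \sum_j F j = \sum_i F (e i).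
  by rewrite (reindex e) //; apply: onW_bij.
(* With no generators all [c i j] vanish, which contradicts freeness since [J] is nonempty; the
   matrix of the [r i j] below has positive size. *)
case: N v r rR Tv cv => [|N] v r rR Tv cv.
  have /(_ (fun=> 1))/(_ _ (e ord0))/eqP : forall b : J -> K,
    (forall i, \sum_j b j *: c i j = 0) -> forall j, b j = 0 by [].
  rewrite oner_eq0 => H; suff: false by []; apply: H => i.
  by rewrite big1 // => j _; have [k ->] := cv i j; rewrite big_ord0 scaler0.
pose p := char_poly (\matrix_(i, j) r i j).
have pv i : poly_action p (v i) = 0.
  rewrite (@poly_action_mx _ _ (\matrix_(i, j) r i j)) => [|j].
    by rewrite Cayley_Hamilton big1 // => j _; rewrite mxE scale0r.
  by rewrite Tv; apply: eq_bigr => k _; rewrite mxE.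
pose B := \matrix_(i, j) A (e i) (e j).
suff pB0 : horner_mx B p = 0.
  rewrite sumE; have -> : \sum_i A (e i) (e i) = \tr B.
    by apply: eq_bigr => i _; rewrite mxE.
  apply: integral_mxtrace pB0; first exact: char_poly_monic.
  by apply: char_poly_polyOver => i j; rewrite mxE; apply: rR.
apply/matrixP=> i j; rewrite [RHS]mxE.
(* Row [i] of [p(B)] gives a relation among the [c l j] that is valid for all [l] at once, so
   freeness kills it. *)
pose b (k : J) := horner_mx B p i (cast_ord cardJ (enum_rank k)).
have -> : horner_mx B p i j = b (e j) by rewrite /b /e enum_valK cast_ordKV.
apply: free_c => l; rewrite sumE.
have [k cE] := cv l (e i).
transitivity (poly_action p (c l (e i))).
  rewrite (@poly_action_mx p n B (fun m => c l (e m))) => [|m].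
    by apply: eq_bigr => m _; rewrite /b /e enum_valK cast_ordKV.
  by rewrite Tc sumE; apply: eq_bigr => q _; rewrite mxE.
by rewrite cE poly_action_sum big1 // => m _; rewrite pv scaler0.
Qed.

(** [T] stabilizes the lattice spanned by the [v s], and acts by [A] on each
    family [c i]; these families need only be jointly free. *)
Lemma integral_trace (S : finType) (v : S -> V) (I : Type) (J : finType)
    (c : I -> J -> V) (A : J -> J -> K) :
    (forall s, exists2 r : S -> K, (forall t, r t \in ring_of_integers K)
                             & T (v s) = \sum_t r t *: v t) ->
    (forall i j, exists k : S -> K, c i j = \sum_s k s *: v s) ->
    (forall i j, T (c i j) = \sum_k A j k *: c i k) ->
    (forall b : J -> K, (forall i, \sum_j b j *: c i j = 0) -> forall j,
      b j = 0) ->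
  \sum_j A j j \in ring_of_integers K.
Proof.
move=> Tv cv; apply: (@integral_trace_ord _ (fun i : 'I_#|S| =>
  v (enum_val i))) => [i|i j].
  have [r rR ->] := Tv (enum_val i); exists (fun j => r (enum_val j)) => [j|];
    first exact: rR.
  by rewrite (reindex _ (onW_bij _ (@enum_val_bij S))).
have [k ->] := cv i j; exists (fun l => k (enum_val l)).
by rewrite (reindex _ (onW_bij _ (@enum_val_bij S))).
Qed.
End IntegralTrace.

(** * Products and coproducts in the group algebra of the square *)

Section GroupAlgebraTensor.
Variables (K : fieldType) (G : finGroupType).
Implicit Types a b c d : group_algebra K G.

Lemma gtens_suml I (r : seq I) (P : pred I) (x : I -> group_algebra K G) b :
  gtens (\sum_(i <- r | P i) x i) b = \sum_(i <- r | P i) gtens (x i) b.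
Proof. exact: (linear_sumlz (gtens (K:=K) (G:=G))). Qed.

Lemma gtens_sumr I (r : seq I) (P : pred I) (x : I -> group_algebra K G) b :
  gtens b (\sum_(i <- r | P i) x i) = \sum_(i <- r | P i) gtens b (x i).
Proof. by rewrite linear_sumr. Qed.

Lemma gtensZl k a b : gtens (k *: a) b = k *: gtens a b.
Proof. exact: (linearZl_LR (gtens (K:=K) (G:=G))). Qed.

Lemma gtensZr k a b : gtens a (k *: b) = k *: gtens a b.
Proof. exact: (linearZr_LR (gtens (K:=K) (G:=G))). Qed.

Lemma gtens0l b : gtens (0 : group_algebra K G) b = 0.
Proof. by rewrite -(scale0r 0) gtensZl scale0r. Qed.

Lemma gtens0r a : gtens a (0 : group_algebra K G) = 0.
Proof. by rewrite -(scale0r 0) gtensZr scale0r. Qed.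

Lemma gtensM a b c d : gtens a b * gtens c d = gtens (a * c) (b * d).
Proof.
apply/ffunP=> -[x y]; rewrite !ffunE /= mulr_suml.
under [RHS]eq_bigr do rewrite mulr_sumr.
rewrite [RHS]pair_bigA; apply: eq_bigr => -[s t] _ /=.
by rewrite !ffunE /= mulrACA.
Qed.

Lemma gtens11 : gtens (1 : group_algebra K G) 1 = 1.
Proof. exact: gtens_gelt. Qed.

Lemma gcomulE a : gcomul a = \sum_g (a g : K) *: gelt K (g, g).
Proof. by apply: eq_bigr => g _; rewrite gtens_gelt. Qed.

Lemma gcomul_gelt (g : G) : gcomul (gelt K g) = gelt K (g, g).
Proof.
rewrite gcomulE (bigD1 g) //= ffunE eqxx scale1r big1 ?addr0 // => h /negbTE hg.
by rewrite ffunE hg scale0r.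
Qed.

Lemma gcomulP k a b : gcomul (k *: a + b) = k *: gcomul a + gcomul b.
Proof.
rewrite !gcomulE scaler_sumr -big_split /=.
by apply: eq_bigr => g _; rewrite !ffunE scalerDl scalerA.
Qed.

Lemma gcomul_sum I (r : seq I) (P : pred I) (k : I -> K)
    (x : I -> group_algebra K G) :
  gcomul (\sum_(i <- r | P i) k i *: x i) =
  \sum_(i <- r | P i) k i *: gcomul (x i).
Proof.
rewrite gcomulE; under eq_bigr do rewrite sum_ffunE scaler_suml.
rewrite exchange_big /=; apply: eq_bigr => i _; rewrite gcomulE scaler_sumr.
by apply: eq_bigr => g _; rewrite ffunE scalerA.
Qed.

Lemma gcomulM a b : gcomul (a * b) = gcomul a * gcomul b.
Proof.
transitivity (\sum_g \sum_h (a g * b h : K) *: gcomul (gelt K (g * h)%g)).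
  rewrite {1}[a]group_algebra_sum {1}[b]group_algebra_sum mulr_suml.
  under eq_bigr do rewrite mulr_sumr.
  rewrite pair_bigA [RHS]pair_bigA -gcomul_sum; congr gcomul.
  by apply: eq_bigr => -[g h] _; rewrite -scalerAl -scalerAr geltM scalerA.
rewrite [gcomul a]gcomulE [gcomul b]gcomulE mulr_suml; apply: eq_bigr => g _.
rewrite mulr_sumr; apply: eq_bigr => h _.
by rewrite -scalerAl -scalerAr geltM scalerA gcomul_gelt.
Qed.
End GroupAlgebraTensor.

(** * Characters of the plane over the prime field *)

Section AdditiveCharacter.
Variables (K : fieldType) (p : nat) (zeta : K).
Hypotheses (p_prime : prime p) (prim_zeta : p.-primitive_root zeta).

Definition addchar (k : 'F_p) : K := zeta ^+ k.

Lemma addcharD k l : addchar (k + l) = addchar k * addchar l.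
Proof.
rewrite /addchar -exprD -(prim_expr_mod prim_zeta (k + l)) /=.
by congr (_ ^+ (_ %% _)); rewrite Fp_cast.
Qed.

Lemma addchar0 : addchar 0 = 1. Proof. by []. Qed.

Lemma addchar_neq0 k : addchar k != 0.
Proof.
apply/eqP=> z0; have := addcharD k (- k).
by rewrite subrr addchar0 z0 mul0r => /eqP; rewrite oner_eq0.
Qed.

Lemma addcharN k : addchar (- k) = (addchar k)^-1.
Proof.
apply: (mulfI (addchar_neq0 k)).
by rewrite -addcharD subrr addchar0 divff ?addchar_neq0.
Qed.

Lemma addchar_eq1 k : (addchar k == 1) = (k == 0).
Proof.
rewrite /addchar -(prim_order_dvd prim_zeta) -val_eqE /=.
apply/idP/eqP=> [|-> //]; have ltkp : (k < p)%N.
  by rewrite -[X in (_ < X)%N](Fp_cast p_prime) ltn_ord.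
by case: (nat_of_ord k) ltkp => //= m ltmp /(dvdn_leq (ltn0Sn m));
  rewrite leqNgt ltmp.
Qed.

Local Notation I := ('F_p * 'F_p)%type.
(** Through this symmetric form the plane also indexes its own characters. *)
Definition pairing (i j : I) : 'F_p := i.1 * j.1 + i.2 * j.2.

Lemma pairingC i j : pairing i j = pairing j i.
Proof. by rewrite /pairing mulrC [_.2 * _]mulrC. Qed.
Lemma pairingDr i j k : pairing i (j + k) = pairing i j + pairing i k.
Proof. by rewrite /pairing !mulrDr addrACA. Qed.
Lemma pairingDl i j k : pairing (i + j) k = pairing i k + pairing j k.
Proof. by rewrite !(pairingC _ k) pairingDr. Qed.
Lemma pairingNl i j : pairing (- i) j = - pairing i j.
Proof. by rewrite /pairing !mulNr opprD. Qed.
Lemma pairingNr i j : pairing i (- j) = - pairing i j.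
Proof. by rewrite !(pairingC i) pairingNl. Qed.
Lemma pairing0r i : pairing i 0 = 0.
Proof. by rewrite /pairing !mulr0 addr0. Qed.

Lemma addchar_orthogonal i :
  \sum_j addchar (pairing i j) = if i == 0 then (p ^ 2)%:R else 0.
Proof.
case: eqP => [->|/eqP i0].
  under eq_bigr do rewrite pairingC pairing0r addchar0.
  by rewrite sumr_const card_prod !card_Fp // mulnn.
have [j0 ij0] : exists j0, pairing i j0 != 0.
  case: i i0 => a b; rewrite -pair_eqE /= negb_and => /orP[a0|b0].
    by exists (1, 0); rewrite /pairing /= mulr1 mulr0 addr0.
  by exists (0, 1); rewrite /pairing /= mulr1 mulr0 add0r.
(* Translation by [j0] multiplies the sum by [addchar (pairing i j0)], which is not 1, so the sum
   vanishes. *)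
set S := \sum_j _; have: S = addchar (pairing i j0) * S.
  rewrite {1}/S (reindex_inj (addrI j0)) mulr_sumr.
  by apply: eq_bigr => j _; rewrite pairingDr addcharD.
move/eqP; rewrite -subr_eq0 -{1}[S]mul1r -mulrBl mulf_eq0 subr_eq0 eq_sym.
by rewrite addchar_eq1 (negbTE ij0) => /eqP.
Qed.
End AdditiveCharacter.

(** * The bicharacter twist and a comodule of dimension [p ^ 2] *)

Section BicharacterTwist.
Variables (K : fieldType) (p : nat) (zeta : K) (G : finGroupType).
Hypotheses (p_prime : prime p) (prim_zeta : p.-primitive_root zeta).
Hypothesis (pK : p%:R != 0 :> K).
Local Notation I := ('F_p * 'F_p)%type.
Variable mu : I -> G.
Hypothesis muD : forall i j, mu (i + j) = (mu i * mu j)%g.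
Local Notation z := (@addchar K p zeta).
Local Notation zD := (addcharD p_prime prim_zeta).
Local Notation zN := (addcharN p_prime prim_zeta).
Local Notation z_neq0 := (addchar_neq0 p_prime prim_zeta).
Local Notation z_orth := (addchar_orthogonal p_prime prim_zeta).

(** The idempotent [e_phi] of the character [pairing i], pushed into [K[G]] along [mu]. *)
Definition idem i : group_algebra K G :=
  (p ^ 2)%:R^-1 *: \sum_j z (- pairing i j) *: gelt K (mu j).

Let p2K : (p ^ 2)%:R != 0 :> K.
Proof. by rewrite natrX expf_neq0. Qed.

Lemma mu0 : mu 0 = 1%g.
Proof. by apply: (mulgI (mu 0)); rewrite -muD addr0 mulg1. Qed.

Lemma gelt_idem i j : gelt K (mu j) * idem i = z (pairing i j) *: idem i.
Proof.
rewrite /idem -scalerAr [RHS]scalerA mulrC -scalerA; congr (_ *: _).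
rewrite [in RHS](reindex_inj (addrI j)) mulr_sumr scaler_sumr.
apply: eq_bigr => k _; rewrite -scalerAr geltM -muD scalerA -zD.
by rewrite pairingDr (opprD (pairing i j)) addNKr.
Qed.

Lemma idemM i j : idem i * idem j = (i == j)%:R *: idem j.
Proof.
rewrite {1}/idem -scalerAl mulr_suml.
under eq_bigr do rewrite -scalerAl gelt_idem scalerA -zD addrC -pairingNl
  -pairingDl.
rewrite -scaler_suml scalerA z_orth subr_eq0 eq_sym.
by case: eqP => _; rewrite ?mulr0 ?scale0r // mulVf.
Qed.

Lemma idem_sum1 : \sum_i idem i = 1.
Proof.
rewrite /idem -scaler_sumr exchange_big /=.
have zE j : \sum_i z (- pairing i j) = (j == 0)%:R * (p ^ 2)%:R.
  rewrite (reindex_inj (@oppr_inj _ : injective (fun i : I => - i))) /=.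
  under eq_bigr do rewrite pairingNl opprK pairingC.
  by rewrite z_orth; case: eqP; rewrite ?mul1r ?mul0r.
under eq_bigr do rewrite -scaler_suml zE.
rewrite (bigD1 (0 : I)) //= big1 => [|j /negbTE->];
  last by rewrite mul0r scale0r.
by rewrite ?eqxx mul1r addr0 scalerA mulVf // scale1r mu0.
Qed.

Definition diag_tensor (a : I -> I -> K) : group_algebra K (G * G)%type :=
  \sum_i \sum_j a i j *: gtens (idem i) (idem j).

Lemma diag_tensor_gtensl a i j x y :
  diag_tensor a * gtens (idem i * x) (idem j * y) =
  a i j *: gtens (idem i * x) (idem j * y).
Proof.
rewrite /diag_tensor mulr_suml (bigD1 i) //= mulr_suml (bigD1 j) //=.
rewrite -scalerAl gtensM !mulrA !idemM !eqxx !scale1r [X in _ + X + _]big1.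
  rewrite addr0 big1 ?addr0 // => k /negbTE ki;
    rewrite mulr_suml big1 // => l _.
  by rewrite -scalerAl gtensM !mulrA !idemM ki scale0r mul0r gtens0l scaler0.
move=> l /negbTE lj.
by rewrite -scalerAl gtensM !mulrA !idemM lj scale0r mul0r gtens0r scaler0.
Qed.

Lemma diag_tensor_gtensr a i j x y :
  gtens (x * idem i) (y * idem j) * diag_tensor a =
  a i j *: gtens (x * idem i) (y * idem j).
Proof.
rewrite /diag_tensor mulr_sumr (bigD1 i) //= mulr_sumr (bigD1 j) //=.
rewrite -scalerAr gtensM -!mulrA !idemM !eqxx !scale1r [X in _ + X + _]big1.
  rewrite addr0 big1 ?addr0 // => k ki; rewrite mulr_sumr big1 // => l _.
  rewrite -scalerAr gtensM -!mulrA !idemM [i == k]eq_sym (negbTE ki) scale0r.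
  by rewrite mulr0 gtens0l scaler0.
move=> l lj; rewrite -scalerAr gtensM -!mulrA !idemM [j == l]eq_sym (negbTE lj).
by rewrite scale0r mulr0 gtens0r scaler0.
Qed.

Lemma diag_tensorM a b :
  diag_tensor a * diag_tensor b = diag_tensor (fun i j => a i j * b i j).
Proof.
rewrite {2}/diag_tensor mulr_sumr; apply: eq_bigr => i _.
rewrite mulr_sumr; apply: eq_bigr => j _; rewrite -scalerAr.
by rewrite -[idem i]mulr1 -[idem j]mulr1 diag_tensor_gtensl scalerA mulrC.
Qed.

Lemma diag_tensor1 : diag_tensor (fun _ _ => 1) = 1.
Proof.
rewrite /diag_tensor -gtens11 -idem_sum1 gtens_suml; apply: eq_bigr => i _.
by rewrite gtens_sumr; apply: eq_bigr => j _; rewrite scale1r.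
Qed.

(** It suffices to multiply by each tensor of [e_i] and [e_j], since these sum to 1. There the
    grouplike elements act by the character [i + j], and orthogonality selects [i + j = k]. *)
Lemma gcomul_idem k :
  gcomul (idem k) = \sum_i gtens (idem i) (idem (k - i)).
Proof.
have gc i j : gcomul (idem k) * gtens (idem i) (idem j) =
    (i + j == k)%:R *: gtens (idem i) (idem j).
  rewrite {1}/idem scaler_sumr; under eq_bigr do rewrite scalerA.
  rewrite gcomul_sum mulr_suml.
  under eq_bigr do rewrite gcomul_gelt -gtens_gelt -scalerAl gtensM
    !gelt_idem gtensZl gtensZr !scalerA -!mulrA -zD -zD -pairingDl addrC
    -pairingNl -pairingDl.
  rewrite -scaler_suml -mulr_sumr z_orth subr_eq0.
  by case: eqP => _; rewrite ?mulr0 ?scale0r // mulVf.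
rewrite -[LHS]mulr1 -diag_tensor1 /diag_tensor mulr_sumr.
apply: eq_bigr => i _; rewrite mulr_sumr (bigD1 (k - i)) //= scale1r gc.
rewrite [i + _]addrC subrK eqxx scale1r big1 ?addr0 // => j jki;
  rewrite scale1r gc.
by rewrite eq_sym [i + j]addrC -subr_eq eq_sym (negbTE jki) scale0r.
Qed.

(** A bicharacter is a 2-cocycle. This one is not symmetric; it is the factor met when a shift
    passes a clock matrix. *)
Definition bichar (i j : I) : K := z (i.1 * j.2).

Definition bitwist := diag_tensor bichar.
Definition bitwistV := diag_tensor (fun i j => (bichar i j)^-1).

Lemma bitwistVr : bitwist * bitwistV = 1.
Proof.
rewrite diag_tensorM -diag_tensor1 /diag_tensor; apply: eq_bigr => i _.
by apply: eq_bigr => j _; rewrite divff ?z_neq0.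
Qed.

Lemma bitwistVl : bitwistV * bitwist = 1.
Proof.
rewrite diag_tensorM -diag_tensor1 /diag_tensor; apply: eq_bigr => i _.
by apply: eq_bigr => j _; rewrite mulVf ?z_neq0.
Qed.

Definition bicomul a := bitwist * gcomul a * bitwistV.

Lemma bicomul_sum (A : Type) (r : seq A) (P : pred A) (k : A -> K)
    (x : A -> group_algebra K G) :
  bicomul (\sum_(i <- r | P i) k i *: x i) =
  \sum_(i <- r | P i) k i *: bicomul (x i).
Proof.
rewrite /bicomul gcomul_sum; move: bitwist bitwistV => a b.
rewrite mulr_sumr mulr_suml.
by apply: eq_bigr => i _; rewrite -scalerAr -scalerAl.
Qed.

Lemma bicomulP k a b : bicomul (k *: a + b) = k *: bicomul a + bicomul b.
Proof. by rewrite /bicomul gcomulP mulrDr mulrDl -scalerAr -scalerAl. Qed.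

Lemma bicomul0 : bicomul 0 = 0.
Proof. by have := bicomulP (- 1) 0 0; rewrite scaler0 addr0 scaleN1r addNr. Qed.

Definition corner (g : G) i j := idem i * gelt K g * idem j.

(** The coproduct of [e_k g e_l] splits each idempotent and doubles [g]. On each resulting term the
    twist acts on the left, and its inverse on the right, by a scalar. *)
Lemma bicomul_corner g k l :
  bicomul (corner g k l) = \sum_i \sum_j
    (bichar i (k - i) / bichar j (l - j)) *:
      gtens (corner g i j) (corner g (k - i) (l - j)).
Proof.
rewrite /bicomul.
have -> : gcomul (corner g k l) =
    \sum_i \sum_j gtens (corner g i j) (corner g (k - i) (l - j)).
  rewrite /corner !gcomulM !gcomul_idem gcomul_gelt -gtens_gelt.
  rewrite !mulr_suml; apply: eq_bigr => i _.
  by rewrite mulr_sumr; apply: eq_bigr => j _; rewrite !gtensM.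
have twE i j i' j' : bitwist * gtens (corner g i j) (corner g i' j') * bitwistV
  =
    (bichar i i' / bichar j j') *: gtens (corner g i j) (corner g i' j').
  rewrite /corner -(mulrA (idem i)) -(mulrA (idem i')) diag_tensor_gtensl.
  by rewrite -scalerAl !mulrA diag_tensor_gtensr scalerA.
move: bitwist bitwistV twE => a b twE.
rewrite mulr_sumr mulr_suml; apply: eq_bigr => i _.
by rewrite mulr_sumr mulr_suml; apply: eq_bigr => j _.
Qed.

(** Clock-and-shift matrices: projective representations of the dual of [M]
    with cocycle [bichar], respectively its inverse. *)
Definition clock (i : I) (r s : 'F_p) : K := (s == r + i.1)%:R * z (r * i.2).
Definition coclock (i : I) (r s : 'F_p) : K := (s == r + i.1)%:R * z (- (r *
  i.2)).

(** Only the index [r + i.1] contributes; passing from row [r] to row [r + i.1] multiplies the phase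
    of [j] by [z (i.1 * j.2)]. *)
Lemma clockM i j r s :
  \sum_m clock i r m * clock j m s = bichar i j * clock (i + j) r s.
Proof.
rewrite /clock (bigD1 (r + i.1)) //= eqxx mul1r big1 ?addr0 => [|m /negbTE->].
  rewrite /= addrA mulrCA [RHS]mulrCA /bichar -!zD; congr (_ * z _).
  by rewrite mulrDl mulrDr addrA addrC.
by rewrite !mul0r.
Qed.

Lemma coclockM i j r s :
  \sum_m coclock i r m * coclock j m s = (bichar i j)^-1 * coclock (i + j) r s.
Proof.
rewrite /coclock (bigD1 (r + i.1)) //= eqxx mul1r big1 ?addr0 => [|m /negbTE->].
  rewrite /= addrA mulrCA [RHS]mulrCA /bichar -zN -!zD; congr (_ * z _).
  by rewrite mulrDl mulrDr -!opprD; congr (- _); rewrite addrA addrC.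
by rewrite !mul0r.
Qed.

(** Matrix coefficients of the comodule: the first coordinates of [x] and [y] index the clock matrix
    attached to the left idempotent, the second ones the coclock matrix attached to the right
    idempotent. *)
Definition coeff (g : G) (x y : I) : group_algebra K G :=
  \sum_i \sum_j (clock i x.1 y.1 * coclock j x.2 y.2) *: corner g i j.

(** The scalars in [bicomul_corner] are exactly those that [clockM] and [coclockM] produce, so the
    twisted coproduct becomes matrix multiplication of coefficients. *)
Lemma bicomul_coeff g x y :
  bicomul (coeff g x y) = \sum_m gtens (coeff g x m) (coeff g m y).
Proof.
transitivity (\sum_i \sum_j \sum_k \sum_l
   ((bichar i k * clock (i + k) x.1 y.1) *
    ((bichar j l)^-1 * coclock (j + l) x.2 y.2)) *:
     gtens (corner g i j) (corner g k l)).
  rewrite /coeff pair_bigA bicomul_sum -(pair_bigA _ (fun k l =>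
    (clock k x.1 y.1 * coclock l x.2 y.2) *: bicomul (corner g k l))) /=.
  under eq_bigr do under eq_bigr do rewrite bicomul_corner scaler_sumr.
  under eq_bigr do rewrite exchange_big /=.
  rewrite exchange_big /=; apply: eq_bigr => i _.
  under eq_bigr do under eq_bigr do rewrite scaler_sumr.
  under eq_bigr do rewrite exchange_big /=.
  rewrite exchange_big /=; apply: eq_bigr => j _.
  (* With [k] replaced by [i + k] and [l] by [j + l], the second tensor factor is indexed
     independently of the first. *)
  rewrite (reindex_inj (addrI i)) /=; apply: eq_bigr => k _.
  rewrite (reindex_inj (addrI j)) /=; apply: eq_bigr => l _.
  rewrite scalerA ![_ + _ - _]addrC !addKr; congr (_ *: _).
  by rewrite mulrACA [clock _ _ _ * _]mulrC [coclock _ _ _ * _]mulrC.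
under [RHS]eq_bigr => m _.
  rewrite {1}/coeff gtens_suml.
  under eq_bigr do rewrite gtens_suml; over.
rewrite /= [RHS]exchange_big /=; apply: eq_bigr => i _.
rewrite [RHS]exchange_big /=; apply: eq_bigr => j _.
under [RHS]eq_bigr => m _.
  rewrite gtensZl /coeff gtens_sumr scaler_sumr.
  under eq_bigr do rewrite gtens_sumr scaler_sumr; over.
rewrite /= [RHS]exchange_big /=; apply: eq_bigr => k _.
rewrite [RHS]exchange_big /=; apply: eq_bigr => l _.
under [RHS]eq_bigr do rewrite gtensZr scalerA mulrACA.
rewrite -scaler_suml; congr (_ *: _); rewrite -clockM -coclockM mulr_suml.
under eq_bigr do rewrite mulr_sumr.
by rewrite pair_bigA.
Qed.

(** A nonzero shift has no diagonal entries and a nontrivial phase sums to zero, so only [i = j = 0]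
    has nonzero trace. The resulting element is the cocharacter [c_g]. *)
Lemma coeff_trace g : \sum_x coeff g x x = (p ^ 2)%:R *: corner g 0 0.
Proof.
rewrite /coeff exchange_big /=.
under eq_bigr do rewrite exchange_big /=.
have tr i j : \sum_x clock i x.1 x.1 * coclock j x.2 x.2 =
    if (i == 0) && (j == 0) then (p ^ 2)%:R else 0.
  rewrite /clock /coclock; have r0 (r s : 'F_p) : (r == r + s) = (s == 0).
    by rewrite -subr_eq0 opprD addNKr oppr_eq0.
  under eq_bigr do rewrite !r0 mulrACA -zD.
  rewrite -mulr_sumr; case: i j => [i1 i2] [j1 j2] /=.
  have -> : \sum_(x : I) z (x.1 * i2 - x.2 * j2) =
            \sum_x z (pairing (i2, - j2) x).
    apply: eq_bigr => x _; rewrite /pairing /= mulNr.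
    by rewrite mulrC [x.2 * _]mulrC.
  rewrite z_orth -!pair_eqE /= oppr_eq0.
  by case: (i1 == 0); case: (j1 == 0); case: (i2 == 0); case: (j2 == 0);
     rewrite /= ?(mulr1n, mulr0n, mul0r, mulr0, mul1r).
rewrite (bigD1 (0 : I)) //= (bigD1 (0 : I)) //= -scaler_suml tr !eqxx [X in _ +
  X + _]big1.
  rewrite addr0 big1 ?addr0 // => i i0; rewrite big1 // => j _.
  by rewrite -scaler_suml tr (negbTE i0) scale0r.
by move=> j j0; rewrite -scaler_suml tr (negbTE j0) andbF scale0r.
Qed.
End BicharacterTwist.

(** * Dual bases of finitely generated projective orders *)

Section DualBasis.
Variables (K : fieldType) (R : subringClosed K) (V : vectType K).
Variable X : submodClosed (restrict_scalars R V).

(** Factored through the tensor product, this map extends the form [h] on [X] to all of [V]. *)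
Definition scalar_form (h : submodule X -> subring R) (a : submodule X)
    (k : restrict_scalars R K^o) : restrict_scalars R K^o := (val (h a) : K) *
      (k : K).

Fact scalar_form_bilinear (h : {linear submodule X -> (subring R)^o}) :
  bilinear_for *:%R *:%R (scalar_form h).
Proof.
split=> [k r x y | x r k l]; rewrite /scalar_form.
  rewrite linearP /=.
  transitivity (((val r : K) * val (h x) + val (h y)) * (k : K)) => //.
  by rewrite mulrDl -mulrA.
transitivity ((val (h x) : K) * ((val r : K) * (k : K) + (l : K))) => //.
by rewrite mulrDr mulrCA.
Qed.
HB.instance Definition _ (h : {linear submodule X -> (subring R)^o}) :=
  bilinear_isBilinear.Build (subring R) (submodule X) (restrict_scalars R K^o)
    (restrict_scalars R K^o) *:%R *:%R (scalar_form h) (scalar_form_bilinear h).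

Lemma submodule_val_sum n (r : 'I_n -> subring R) (x : 'I_n -> submodule X) :
  (val (\sum_i r i *: x i) : V) = \sum_i (val (r i) : K) *: (val (x i) : V).
Proof.
rewrite [LHS](raddf_sum (val : submodule X -> restrict_scalars R V)).
by apply: eq_bigr => i _.
Qed.

(** The projection onto the span of the generators and the identity agree on all scalar multiples of
    elements of [X]; uniqueness in the universal property makes them equal. *)
Lemma extension_span n (x : 'I_n -> submodule X) :
    (forall y, exists r : 'I_n -> subring R, y = \sum_i r i *: x i) ->
    is_tensor (@extension_map K R V X : {bilinear _ -> _ -> _}) ->
  forall v : V, exists k : 'I_n -> K, v = \sum_i k i *: (val (x i) : V).
Proof.
move=> gen_x tensX; pose xs := [tuple (val (x i) : V) | i < n].
pose g (v : restrict_scalars R V) : restrict_scalars R V := projv <<xs>> (v :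
  V).
have g_lin : linear g.
  move=> r u v; rewrite /g.
  by transitivity (projv <<xs>> (val r *: (u : V) + v)) => //; rewrite linearP.
pose gM := GRing.isLinear.Build _ _ _ _ g g_lin.
pose gL : {linear restrict_scalars R V -> restrict_scalars R V} := HB.pack g gM.
have Ux (y : submodule X) : (val y : V) \in <<xs>>%VS.
  have [r ->] := gen_x y; rewrite submodule_val_sum; apply: memv_suml => i _.
  by apply/memvZ/memv_span/mapP; exists i; rewrite ?mem_enum // tnth_mktuple.
have gid v : projv <<xs>> v = v.
  have [f _ f_uniq] := tensX _ (@extension_map K R V X : {bilinear _ -> _ ->
    _}).
  have -> : projv <<xs>> v = f v.
    rewrite -(f_uniq gL) // => y k; rewrite /= /g /extension_map.
    by rewrite linearZ /= projv_id ?Ux.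
  by rewrite -(f_uniq idfun).
move=> v; have : v \in <<xs>>%VS by rewrite -(gid v) memv_proj.
move/coord_span=> ->; exists (fun i => coord xs i v).
apply: eq_bigr => i _; congr (_ *: _).
by rewrite -tnth_nth tnth_mktuple.
Qed.

(** Projectivity splits the surjection from a free module onto [X]; the coordinates of the
    splitting, extended to [V] by the universal property, are the forms [phi i]. They stand in for a
    basis, as [X] may fail to be free. *)
Lemma dual_basis :
    finitely_generated (submodule X) -> projective (submodule X) ->
    is_tensor (@extension_map K R V X : {bilinear _ -> _ -> _}) ->
  exists (n : nat) (v : 'I_n -> V) (phi : 'I_n -> {linear V -> K^o}),
    [/\ forall i, v i \in X,
        forall i u, u \in X -> phi i u \in R
      & forall u, u = \sum_i (phi i u : K) *: v i].
Proof.
move=> [n [x gen_x]] projX tensX; have span_x := extension_span gen_x tensX.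
pose comb (r : {ffun 'I_n -> (subring R)^o}) : submodule X := \sum_i r i *: x i.
have comb_lin : linear comb.
  move=> k r s; rewrite /comb scaler_sumr -big_split /=; apply: eq_bigr => i _.
  by rewrite !ffunE scalerDl scalerA.
pose combM := GRing.isLinear.Build _ _ _ _ comb comb_lin.
pose combL : {linear {ffun 'I_n -> (subring R)^o} -> submodule X} :=
  HB.pack comb combM.
have [|h hK] := projX _ _ combL (idfun : {linear submodule X -> submodule X}).
  by move=> y; have [r ->] := gen_x y; exists [ffun i => r i]; rewrite /= /comb;
    apply: eq_bigr => i _; rewrite ffunE.
pose hi i (y : submodule X) : (subring R)^o := h y i.
have hi_lin i : linear (hi i) by move=> k y z; rewrite /hi linearP !ffunE.
pose hiL i : {linear submodule X -> (subring R)^o} :=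
  HB.pack (hi i) (GRing.isLinear.Build _ _ _ _ (hi i) (hi_lin i)).
have /fin_all_exists[phi phiE] (i : 'I_n) : exists f : {linear V -> K^o},
    forall y k, f (k *: (val y : V)) = k * val (hi i y) :> K.
  have [F FE _] := tensX _ (scalar_form (hiL i) : {bilinear _ -> _ -> _}).
  have FE' (y : submodule X) (k : K) : F (k *: (val y : V)) = k * val (hi i y)
    :> K.
    by rewrite (FE y k) /= /scalar_form mulrC.
  pose f (v : V) : K^o := F v.
  have fD u v : f (u + v) = f u + f v by apply: (raddfD F).
  (* The extension [F] is only linear over the subring. Linearity over [K] comes from its values on
     multiples of the generators, which span [V]. *)
  have f_lin : linear f.
    move=> k u v; rewrite fD; congr (_ + _).
    have [a ->] := span_x u; rewrite scaler_sumr.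
    have fsum (b : 'I_n -> K) : f (\sum_j b j *: (val (x j) : V)) =
       \sum_j b j * val (hi i (x j)) :> K.
      elim/big_ind2: _ => [|u1 k1 u2 k2 <- <- //|j _]; last exact: FE'.
      by apply: (raddf0 F).
    under eq_bigr do rewrite scalerA.
    rewrite !fsum scaler_sumr; apply: eq_bigr => j _; exact: esym (mulrA _ _ _).
  by exists (HB.pack f (GRing.isLinear.Build _ _ _ _ f f_lin) : {linear V ->
    K^o}).
exists n, (fun i => val (x i)), phi.
have hXE (y : submodule X) : (val y : V) = \sum_i (val (hi i y) : K) *: (val (x
  i) : V).
  by rewrite -submodule_val_sum -[in LHS](hK y : comb (h y) = y).
have phiX i (y : submodule X) : phi i (val y : V) = val (hi i y) :> K.
  by rewrite -(scale1r (val y : V)) phiE mul1r.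
split=> [i|i u uX|u].
- exact: (valP (x i)).
- by rewrite (phiX i (Sub u uX)); apply: (valP (hi i _)).
- have [a ->] := span_x u.
  under [RHS]eq_bigr do rewrite linear_sum scaler_suml.
  rewrite exchange_big /=; apply: eq_bigr => j _.
  under eq_bigr do rewrite phiE -scalerA.
  by rewrite -scaler_sumr -hXE.
Qed.
End DualBasis.

(** * Class functions of a subgroup as linear forms *)

Section Support.
Variables (K : fieldType) (G : finGroupType) (L : {group G}).
Implicit Types a b : group_algebra K G.

Lemma gelt_mulE g a h : (gelt K g * a) h = a (g^-1 * h)%g.
Proof.
rewrite ffunE (bigD1 g) //= ffunE eqxx mul1r big1 ?addr0 // => y /negbTE yg.
by rewrite ffunE yg mul0r.
Qed.

Lemma mul_geltE g a h : (a * gelt K g) h = a (h * g^-1)%g.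
Proof.
rewrite ffunE (bigD1 (h * g^-1)%g) //= ffunE invMg invgK mulgKV eqxx mulr1.
rewrite big1 ?addr0 // => y yhg; rewrite ffunE; case: eqP => [yg|_].
  by rewrite -yg invMg invgK mulKVg eqxx in yhg.
by rewrite mulr0.
Qed.

Definition supported a := forall g, g \notin L -> a g = 0 :> K.

Lemma supported_gelt g : g \in L -> supported (gelt K g).
Proof. by move=> gL h; rewrite ffunE; case: eqP => [->|]; rewrite ?gL. Qed.

Lemma supportedZ k a : supported a -> supported (k *: a).
Proof. by move=> aL g gL; rewrite ffunE aL // scaler0. Qed.

Lemma supported_sum I (r : seq I) (P : pred I) (x : I -> group_algebra K G) :
  (forall i, supported (x i)) -> supported (\sum_(i <- r | P i) x i).
Proof. by move=> xL g gL; rewrite sum_ffunE big1 // => i _; apply: xL. Qed.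

Lemma supportedM a b : supported a -> supported b -> supported (a * b).
Proof.
move=> aL bL g gL; rewrite ffunE big1 // => h _.
have [hL|/aL->] := boolP (h \in L); last by rewrite mul0r.
by rewrite bL ?mulr0 // groupMl // groupV.
Qed.

(** The linear extension of a class function of [L]: it is the order of the centralizer of [a] in
    [L] on the [L]-conjugates of [a], and zero on other group elements. *)
Definition class_trace (a : G) (x : group_algebra K G) : K :=
  \sum_(s in L) (x (s * a * s^-1)%g : K).

Lemma class_trace_sum (a : G) I (r : seq I) (P : pred I) (x : I ->
  group_algebra K G) :
  class_trace a (\sum_(i <- r | P i) x i) = \sum_(i <- r | P i) class_trace a
    (x i).
Proof. by rewrite exchange_big; apply: eq_bigr => s _; rewrite sum_ffunE. Qed.

Lemma class_traceZ (a : G) k x : class_trace a (k *: x) = k * class_trace a x.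
Proof. by rewrite mulr_sumr; apply: eq_bigr => s _; rewrite ffunE. Qed.

Lemma class_trace_comb (a : G) (I J : finType) k (c : I -> J -> K)
    (t : I -> J -> group_algebra K G) u :
  class_trace a ((k *: \sum_i \sum_j c i j *: t i j) * u) =
  k * \sum_i \sum_j c i j * class_trace a (t i j * u).
Proof.
rewrite -scalerAl class_traceZ mulr_suml class_trace_sum; congr (_ * _).
apply: eq_bigr => i _; rewrite mulr_suml class_trace_sum.
by apply: eq_bigr => j _; rewrite -scalerAl class_traceZ.
Qed.

Lemma class_trace_gelt (a y : G) :
  class_trace a (gelt K y) = #|[set s in L | (s * a * s^-1)%g == y]|%:R.
Proof.
rewrite /class_trace -sum1_card natr_sum [LHS]big_mkcond [RHS]big_mkcond;
  apply: eq_bigr => s _.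
by rewrite inE ffunE; case: (s \in L); case: eqP.
Qed.

(** For [l] a group element [g] of [L], this is the substitution of [g s] for [s] in the sum. *)
Lemma class_trace_mulC (a : G) l x : supported l ->
  class_trace a (l * x) = class_trace a (x * l).
Proof.
move=> lL; rewrite [l]group_algebra_sum mulr_suml mulr_sumr !class_trace_sum.
apply: eq_bigr => g _; rewrite -scalerAl -scalerAr !class_traceZ.
have [gL|/lL->] := boolP (g \in L); last by rewrite !mul0r.
congr (_ * _); rewrite /class_trace (reindex_inj (mulgI g)).
apply: eq_big => [s|s _]; first by rewrite groupMl.
by rewrite gelt_mulE mul_geltE invMg !mulgA mulVg mul1g.
Qed.
End Support.

Section ProductTrace.
Variables (K : fieldType) (G : finGroupType) (L : {group G}).

Lemma supported_gtens (a b : group_algebra K G) :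
  supported L a -> supported L b -> supported (setX_group L L) (gtens a b).
Proof.
move=> aL bL [g h]; rewrite inE ffunE /= negb_and => /orP[/aL->|/bL->].
  by rewrite mul0r.
by rewrite mulr0.
Qed.

Lemma supported_gcomul (a : group_algebra K G) :
  supported L a -> supported (setX_group L L) (gcomul a).
Proof.
move=> aL q qL; rewrite gcomulE sum_ffunE big1 // => g _.
have [gL|/aL->] := boolP (g \in L); last by rewrite scale0r ffunE.
have gqL : supported (setX_group L L) (gelt K (g, g)).
  by apply: supported_gelt; rewrite inE gL.
by rewrite ffunE gqL // scaler0.
Qed.

Lemma class_trace_gtens a b (x y : group_algebra K G) :
  class_trace (setX_group L L) (a,
    b) (gtens x y) = class_trace L a x * class_trace L b y.
Proof.
rewrite /class_trace mulr_suml; under [RHS]eq_bigr do rewrite mulr_sumr.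
rewrite pair_big; apply: eq_big => [[s t]|[s t] _]; rewrite ?inE //.
by rewrite ffunE.
Qed.
End ProductTrace.

(** * Integrality of class functions on stable lattices *)

Section IntegralClassTrace.
Variables (K : fieldExtType rat) (G : finGroupType) (L : {group G}).

(** The trace of [x |-> Z x a^-1] on [K[L]]. *)
Lemma integral_class_trace (S : finType) (w : S -> group_algebra K G)
    (Z : group_algebra K G) (a : G) :
    (forall i, exists2 r : S -> K, (forall j, r j \in ring_of_integers K)
                             & Z * w i = \sum_j r j *: w j) ->
    (forall x, exists k : S -> K, x = \sum_j k j *: w j) ->
    supported L Z -> a \in L ->
  class_trace L a Z \in ring_of_integers K.
Proof.
move=> Zw span_w ZL aL.
pose T (x : group_algebra K G) : group_algebra K G := Z * x * gelt K a^-1%g.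
have T_lin : linear T.
  by move=> k x y; rewrite /T mulrDr mulrDl -scalerAr -scalerAl.
pose TL : {linear group_algebra K G -> group_algebra K G} :=
  HB.pack T (GRing.isLinear.Build _ _ _ _ T T_lin).
(* The products of the [w i] with elements [y] of [G] span a lattice stable under [T]: [Z] acts
   integrally on the [w i], and right multiplication by a group element permutes the [y]. The basis
   of [K[L]] is the single free family. *)
pose v (q : S * G) := w q.1 * gelt K q.2.
pose c (_ : unit) (s : subg_of L) := gelt K (sgval s).
have -> : class_trace L a Z = \sum_(s : subg_of L) Z (sgval s * a * (sgval
  s)^-1)%g.
  rewrite /class_trace (reindex_onto sgval (subg L)) /=; last exact: subgK.
  by apply: eq_bigl => s; rewrite sgvalK subgP eqxx.
(* The coefficient of [u] in [Z * s * a^-1] is [Z (u * a * s^-1)]; on the diagonal these are the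
   summands of the class trace. *)
apply: (@integral_trace _ _ TL _ v _ _ c
  (fun s u => Z (sgval u * a * (sgval s)^-1)%g)).
- case=> i y; have [r rR Zwi] := Zw i.
  exists (fun q => if q.2 == (y * a^-1)%g then r q.1 else 0) => [[j u] /=|].
    by case: eqP; rewrite ?rpred0.
  rewrite /= /T /v /= mulrA Zwi -mulrA geltM mulr_suml.
  rewrite -(pair_bigA _ (fun j u => (if u == (y * a^-1)%g then r j else 0) *:
    (w j * gelt K u))) /=; apply: eq_bigr => j _.
  rewrite (bigD1 (y * a^-1)%g) //= eqxx -scalerAl big1 ?addr0 // => u /negbTE->.
  by rewrite scale0r.
- move=> i s; have [k kE] := span_w (c i s).
  exists (fun q => if q.2 == 1%g then k q.1 else 0); rewrite kE.
  rewrite -(pair_bigA _ (fun j u => (if u == 1%g then k j else 0) *: v (j,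
    u))) /=.
  apply: eq_bigr => j _; rewrite (bigD1 1%g) //= eqxx /v /= mulr1.
  by rewrite big1 ?addr0 // => u /negbTE->; rewrite scale0r.
- move=> i s; rewrite /= /T /c -mulrA geltM {1}[Z]group_algebra_sum mulr_suml.
  rewrite (reindex_inj (mulIg (a * (sgval s)^-1)%g)) /=.
  rewrite (bigID (fun u => u \in L)) /= [X in _ + X]big1 ?addr0 => [|u uL];
    last first.
    rewrite ZL ?scale0r ?mul0r // groupMr // groupMl //.
    by rewrite groupV subgP.
  rewrite (reindex_onto sgval (subg L)) /=; last exact: subgK.
  apply: eq_big => [u|u _]; first by rewrite sgvalK subgP eqxx.
  by rewrite -scalerAl geltM !mulgA mulgKV mulgK.
- move=> b /(_ tt) b0 s; move/ffunP/(_ (sgval s)): b0.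
  rewrite sum_ffunE (bigD1 s) //= !ffunE eqxx [_ *: 1]mulr1 big1 ?addr0 // =>
    u us.
  rewrite !ffunE; case: eqP => [/subg_inj su|_]; last by rewrite scaler0.
  by rewrite su eqxx in us.
Qed.
End IntegralClassTrace.

(** * The counit and contraction against a linear form *)

Section Counit.
Variables (K : fieldType) (G : finGroupType).

Lemma gcounit_sum I (r : seq I) (P : pred I) (k : I -> K)
    (x : I -> group_algebra K G) :
  gcounit (\sum_(i <- r | P i) k i *: x i) = \sum_(i <- r | P i) k i * gcounit
    (x i).
Proof.
rewrite /gcounit; under eq_bigr do rewrite sum_ffunE.
rewrite exchange_big /=; apply: eq_bigr => i _; rewrite mulr_sumr.
by apply: eq_bigr => g _; rewrite ffunE.
Qed.

Lemma gcounit_gelt (g : G) : gcounit (gelt K g) = 1.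
Proof.
by rewrite /gcounit (bigD1 g) //= ffunE eqxx big1 ?addr0 // => h /negbTE hg;
  rewrite ffunE hg.
Qed.

Lemma gcounitM (a b : group_algebra K G) : gcounit (a * b) = gcounit a *
  gcounit b.
Proof.
transitivity (gcounit (\sum_(q : G * G) (a q.1 * b q.2 : K) *: gelt K (q.1 *
  q.2)%g)).
  congr gcounit; rewrite {1}[a]group_algebra_sum {1}[b]group_algebra_sum
    mulr_suml.
  under eq_bigr do rewrite mulr_sumr.
  by rewrite pair_bigA; apply: eq_bigr => q _;
    rewrite -scalerAl -scalerAr geltM scalerA.
rewrite gcounit_sum; under eq_bigr do rewrite gcounit_gelt mulr1.
by rewrite -(pair_bigA _ (fun g h => a g * b h : K)) /= /gcounit mulr_suml;
   apply: eq_bigr => g _; rewrite mulr_sumr.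
Qed.

(** This is [id (x) f], contracting the second tensor factor. *)
Definition slice (f : group_algebra K G -> K)
    (t : group_algebra K (G * G)%type) : group_algebra K G :=
  \sum_q ((t q : K) * f (gelt K q.2)) *: gelt K q.1.

Lemma slice_gtens (f : {linear group_algebra K G -> K^o}) a b :
  slice f (gtens a b) = (f b : K) *: a.
Proof.
transitivity (\sum_g \sum_h (a g * b h * f (gelt K h) : K) *: gelt K g).
  by rewrite pair_bigA; apply: eq_bigr => -[g h] _; rewrite ffunE.
rewrite {2}[a]group_algebra_sum scaler_sumr; apply: eq_bigr => g _.
rewrite -scaler_suml scalerA; congr (_ *: _).
rewrite [b in RHS]group_algebra_sum linear_sum mulr_suml.
apply: eq_bigr => h _; rewrite linearZ.
by transitivity ((b h * f (gelt K h)) * (a g : K)) => //;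
  rewrite [RHS]mulrC mulrA.
Qed.

Lemma slice_sum f I (r : seq I) (P : pred I) (x : I -> group_algebra K (G *
  G)%type) :
  slice f (\sum_(i <- r | P i) x i) = \sum_(i <- r | P i) slice f (x i).
Proof.
rewrite /slice exchange_big /=; apply: eq_bigr => q _.
by rewrite sum_ffunE mulr_suml scaler_suml.
Qed.

Lemma sliceZ f k t : slice f (k *: t) = k *: slice f t.
Proof.
by rewrite /slice scaler_sumr; apply: eq_bigr => q _;
  rewrite ffunE scalerA mulrA.
Qed.

Lemma sliceD f s t : slice f (s + t) = slice f s + slice f t.
Proof.
by rewrite /slice -big_split; apply: eq_bigr => q _;
  rewrite ffunE mulrDl scalerDl.
Qed.
End Counit.

(** * Elements and traces forced to be integral by a Hopf order *)

Section HopfOrder.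
Variables (K : fieldExtType rat) (p : nat) (zeta : K) (G : finGroupType).
Hypotheses (p_prime : prime p) (prim_zeta : p.-primitive_root zeta).
Local Notation I := ('F_p * 'F_p)%type.
Variable mu : I -> G.
Hypothesis muD : forall i j, mu (i + j) = (mu i * mu j)%g.
Local Notation R := (ring_of_integers K).
Variables (X : {pred group_algebra K G}) (N : nat) (v : 'I_N -> group_algebra K
  G).
Variable phi : 'I_N -> {linear group_algebra K G -> K^o}.
Hypothesis vX : forall i, v i \in X.
Hypothesis phiX : forall i u, u \in X -> phi i u \in R.
Hypothesis dual_v : forall u, u = \sum_i (phi i u : K) *: v i.
Hypothesis spanX : forall r : 'I_N -> K,
  (forall i, r i \in R) -> \sum_i r i *: v i \in X.
Hypothesis mulX : forall u w, u \in X -> w \in X -> u * w \in X.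
Hypothesis comulX : forall u, u \in X -> exists n (x y : 'I_n -> group_algebra
  K G),
  [/\ forall i, x i \in X, forall i, y i \in X
    & bicomul zeta mu u = \sum_i gtens (x i) (y i)].

Let pK : p%:R != 0 :> K := prime_natr_neq0 K p_prime.
Let p2K : (p ^ 2)%:R != 0 :> K.
Proof. by rewrite natrX expf_neq0. Qed.

Lemma gcounit_idem i : gcounit (idem zeta mu i) = (i == 0)%:R.
Proof.
rewrite /idem scaler_sumr; under eq_bigr do rewrite scalerA.
rewrite gcounit_sum; under eq_bigr do rewrite gcounit_gelt mulr1 -pairingNl.
rewrite -mulr_sumr (addchar_orthogonal p_prime prim_zeta) oppr_eq0.
by case: eqP; rewrite ?mulr0 // mulVf.
Qed.

(** The counit kills every corner except the one at indices [0] and [0], whose coefficients form the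
    identity matrix. This gives the joint freeness of the rows of [coeff]. *)
Lemma gcounit_coeff g x y : gcounit (coeff zeta mu g x y) = (x == y)%:R.
Proof.
rewrite /coeff pair_bigA gcounit_sum (bigD1 ((0 : I), (0 : I))) //= big1 =>
  [|[i j]]; last first.
  rewrite -pair_eqE /= negb_and => ij0.
  rewrite /corner !gcounitM gcounit_gelt !gcounit_idem.
  by case/orP: ij0 => /negbTE->; rewrite ?mul0r ?mulr0.
rewrite addr0 /corner !gcounitM gcounit_gelt !gcounit_idem !eqxx !mulr1.
rewrite /clock /coclock /= !addr0 !mulr0 oppr0 !mulr1 -natrM mulnb.
by rewrite eq_sym [y.2 == _]eq_sym -pair_eqE; case: x y => [? ?] [? ?].
Qed.

Lemma lattice_sum n (r : 'I_n -> K) (x : 'I_n -> group_algebra K G) :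
  (forall i, r i \in R) -> (forall i, x i \in X) -> \sum_i r i *: x i \in X.
Proof.
move=> rR xX; rewrite [\sum_i _]dual_v; apply: spanX => i.
rewrite linear_sum; apply: rpred_sum => j _; rewrite linearZ.
by apply: rpredM; [apply: rR | apply: phiX].
Qed.

Lemma lattice_coord u : u \in X ->
  exists2 r : 'I_N -> K, (forall i, r i \in R) & u = \sum_i r i *: v i.
Proof. by move=> uX; exists (fun i => phi i u : K) => [i|];
  [apply: phiX | ]. Qed.

(** The cocharacter of the comodule with coefficients [coeff g] lies in [X]
    because every integral form on [X] takes an integral value on it. *)
Lemma corner_lattice g : (p ^ 2)%:R *: corner zeta mu g 0 0 \in X.
Proof.
rewrite [_ *: _]dual_v; apply: spanX => i.
move: (phi i) (phiX i) => f fX.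
rewrite -(coeff_trace p_prime prim_zeta) linear_sum.
(* [T] is the twisted coproduct followed by [id (x) f]. It preserves [X] and acts on each row of
   [coeff g] by the matrix of the values of [f] on the coefficients, whose trace is the value to be
   shown integral. *)
pose T u := slice f (bicomul zeta mu u).
have T_lin : linear T.
  by move=> k u w; rewrite /T bicomulP sliceD sliceZ.
pose TL : {linear group_algebra K G -> group_algebra K G} :=
  HB.pack T (GRing.isLinear.Build _ _ _ _ T T_lin).
apply: (@integral_trace _ _ TL _ v _ _ (coeff zeta mu g)
  (fun y m => f (coeff zeta mu g m y))) => [j|x y|x y|b b0 x].
- have [n [x [y [xX yX E]]]] := comulX (vX j).
  apply: lattice_coord; rewrite /= /T E slice_sum.
  by under eq_bigr do rewrite slice_gtens; apply: lattice_sum => // k;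
    apply: fX.
- exists (fun l => phi l (coeff zeta mu g x y) : K); exact: dual_v.
- rewrite /= /T (bicomul_coeff p_prime prim_zeta pK muD) slice_sum.
  by apply: eq_bigr => m _; rewrite slice_gtens.
(* The counit applied to the relation for row [x] isolates [b x]. *)
- have := congr1 (@gcounit K G) (b0 x); rewrite gcounit_sum (bigD1 x) //=.
  rewrite gcounit_coeff eqxx mulr1 big1 ?addr0 => [->|y yx].
    by rewrite /gcounit big1 // => h _; rewrite ffunE.
  by rewrite gcounit_coeff eq_sym (negbTE yx) mulr0.
Qed.

Lemma tensor_lattice_coord x y :
  gtens x y = \sum_(q : 'I_N * 'I_N) (phi q.1 x * phi q.2 y : K) *: gtens (v
    q.1) (v q.2).
Proof.
rewrite {1}[x]dual_v {1}[y]dual_v gtens_suml.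
rewrite -(pair_bigA _ (fun l m => (phi l x * phi m y : K) *: gtens (v l) (v
  m))) /=.
apply: eq_bigr => l _; rewrite gtens_sumr; apply: eq_bigr => m _.
by rewrite gtensZl gtensZr scalerA.
Qed.

Variable L : {group G}.
Hypothesis muL : forall i, mu i \in L.

Lemma supported_idem i : supported L (idem zeta mu i).
Proof.
by apply/supportedZ/supported_sum => j; apply/supportedZ/supported_gelt/muL.
Qed.

Lemma supported_corner g i j : g \in L -> supported L (corner zeta mu g i j).
Proof.
by move=> gL; apply/supportedM/supported_idem/supportedM/supported_gelt/gL/supported_idem.
Qed.

Lemma supported_diag_tensor a : supported (setX_group L L) (diag_tensor zeta mu
  a).
Proof.
apply: supported_sum => i; apply: supported_sum => j; apply: supportedZ.
by apply: supported_gtens; apply: supported_idem.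
Qed.

Lemma class_trace_idem_gelt a g :
  class_trace L a (idem zeta mu 0 * gelt K g) =
  (p ^ 2)%:R^-1 * \sum_j class_trace L a (gelt K (mu j * g)%g).
Proof.
rewrite /idem -scalerAl class_traceZ mulr_suml class_trace_sum; congr (_ * _).
apply: eq_bigr => j _; rewrite -scalerAl class_traceZ geltM.
by rewrite pairingC pairing0r oppr0 addchar0 mul1r.
Qed.

(** The first factor is a sum of tensors from [X] because the cocharacter of [g] lies in [X]; the
    second multiplies the right tensor leg by an element of [X]. Left multiplication by the product
    thus preserves the lattice spanned by the tensors of the [v i]. *)
Lemma integral_corner_trace a b g h : a \in L -> b \in L -> g \in L -> h \in L
  ->
  class_trace (setX_group L L) (a, b)
    (bicomul zeta mu ((p ^ 2)%:R *: corner zeta mu g 0 0) *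
     gtens 1 ((p ^ 2)%:R *: corner zeta mu h 0 0)) \in R.
Proof.
move=> aL bL gL hL; set Z := _ * _.
have [n [x [y [xX yX E]]]] := comulX (corner_lattice g).
have ZE w1 w2 : Z * gtens w1 w2 =
    \sum_k gtens (x k * w1) (y k * ((p ^ 2)%:R *: corner zeta mu h 0 0) * w2).
  rewrite /Z E -mulrA gtensM mulr_suml mul1r.
  by apply: eq_bigr => k _; rewrite gtensM mulrA.
apply: (@integral_class_trace _ _ _ _
  (fun q : 'I_N * 'I_N => gtens (v q.1) (v q.2))) => [[i j]|u||].
- exists (fun q => \sum_k phi q.1 (x k * v i) *
     phi q.2 (y k * ((p ^ 2)%:R *: corner zeta mu h 0 0) * v j) : K) => [q|].
    apply: rpred_sum => k _; apply: rpredM; apply: phiX; first exact: mulX.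
    by apply: mulX => //; apply: mulX => //; apply: corner_lattice.
  rewrite ZE; under eq_bigr do rewrite tensor_lattice_coord.
  by rewrite exchange_big; apply: eq_bigr => q _; rewrite scaler_suml.
- exists (fun q => \sum_s u s * (phi q.1 (gelt K s.1) * phi q.2 (gelt K s.2)) :
  K).
  rewrite {1}[u]group_algebra_sum; under [RHS]eq_bigr do rewrite scaler_suml.
  rewrite [RHS]exchange_big; apply: eq_bigr => -[s t] _ /=.
  rewrite -gtens_gelt tensor_lattice_coord scaler_sumr.
  by apply: eq_bigr => q _; rewrite scalerA.
- apply: supportedM.
    apply: supportedM; last exact: supported_diag_tensor.
    apply: supportedM; first exact: supported_diag_tensor.
    exact/supported_gcomul/supportedZ/supported_corner.
  apply: supported_gtens; last exact/supportedZ/supported_corner.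
  exact: supported_gelt.
- by rewrite inE aL.
Qed.

(** By cyclicity the trace over [L] of [e_i g e_j] vanishes unless [i = j], and the leading
    idempotent of [corner h 0 0] kills every second factor not ending in index [0]. Together they
    force [i = j = 0], where the cocycle factors cancel. *)
Lemma corner_trace a b g h :
  class_trace (setX_group L L) (a, b)
    (bicomul zeta mu ((p ^ 2)%:R *: corner zeta mu g 0 0) *
     gtens 1 ((p ^ 2)%:R *: corner zeta mu h 0 0)) =
  (\sum_j class_trace L a (gelt K (mu j * g)%g)) *
  (\sum_j \sum_k class_trace L b (gelt K (mu j * g * mu k * h)%g)) / (p ^ 2)%:R.
Proof.
have idM := idemM p_prime prim_zeta pK muD.
rewrite -[_ *: corner _ _ g _ _]addr0 bicomulP bicomul0 addr0.
rewrite (bicomul_corner p_prime prim_zeta pK muD) class_trace_comb.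
have corner0 i j : class_trace L a (corner zeta mu g i j) =
    (i == j)%:R * class_trace L a (idem zeta mu j * gelt K g).
  rewrite /corner -class_trace_mulC; last exact: supported_idem.
  rewrite mulrA idM -scalerAl class_traceZ eq_sym.
  have [-> //|_] := eqVneq i j; by rewrite !mul0r.
have cornerM i j : class_trace L b (corner zeta mu g i j * corner zeta mu h 0
  0) =
    (j == 0)%:R * class_trace L b (corner zeta mu g i 0 * corner zeta mu h 0 0).
  have idM0 (k : I) : idem zeta mu k * idem zeta mu 0 = (k == 0)%:R *: idem
    zeta mu 0.
    exact: idM.
  move: idM0; rewrite /corner.
  move: (idem zeta mu) (gelt K g) (gelt K h) => e x y idM0.
  have mulE k : e i * x * e k * (e 0 * y * e 0) = e i * x * (e k * e 0) * (y *
    e 0).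
    by rewrite !mulrA.
  by rewrite !mulE !idM0 -scalerAr -scalerAl class_traceZ eqxx scale1r.
have termE i j i' j' : class_trace (setX_group L L) (a, b)
    (gtens (corner zeta mu g i j) (corner zeta mu g i' j') *
     gtens 1 ((p ^ 2)%:R *: corner zeta mu h 0 0)) =
    ((i == j)%:R * class_trace L a (idem zeta mu j * gelt K g)) *
    ((p ^ 2)%:R * ((j' == 0)%:R *
       class_trace L b (corner zeta mu g i' 0 * corner zeta mu h 0 0))).
  by rewrite gtensM mulr1 class_trace_gtens -scalerAr class_traceZ (cornerM i'
    j') corner0.
under eq_bigr do under eq_bigr do rewrite termE.
(* The second Kronecker factor forces [j = 0], then the first forces [i = 0]. *)
have sumE (c : I -> I -> K) (x y : I -> K) P :
    \sum_i \sum_j c i j * (((i == j)%:R * x j) * (P * ((0 - j == 0)%:R * y (0 -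
      i)))) =
    c 0 0 * (x 0 * (P * y 0)).
  rewrite (bigD1 (0 : I)) //= (bigD1 (0 : I)) //= !sub0r !oppr0 !eqxx !mul1r.
  rewrite big1 ?addr0 => [|j j0].
    rewrite big1 ?addr0 // => i i0; rewrite big1 // => j _;
      rewrite sub0r oppr_eq0.
    have [->|j0] := eqVneq j 0; last by rewrite mul0r !mulr0.
    by rewrite (negbTE i0) !mul0r mulr0.
  by rewrite sub0r oppr_eq0 (negbTE j0) mul0r !mulr0.
rewrite (sumE (fun i j => bichar zeta i (0 - i) / bichar zeta j (0 - j))
  (fun j => class_trace L a (idem zeta mu j * gelt K g))
  (fun i => class_trace L b (corner zeta mu g i 0 * corner zeta mu h 0 0))).
clear sumE termE cornerM corner0.
(* Cyclicity merges the outer idempotents of [e g e h e]; the two that remain are averages over [M],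
   each contributing the inverse of [p ^ 2]. *)
have -> : class_trace L b (corner zeta mu g 0 0 * corner zeta mu h 0 0) =
    (p ^ 2)%:R^-1 * ((p ^ 2)%:R^-1 *
      \sum_j \sum_k class_trace L b (gelt K (mu j * g * mu k * h)%g)).
  have -> : corner zeta mu g 0 0 * corner zeta mu h 0 0 =
      idem zeta mu 0 * gelt K g * idem zeta mu 0 * gelt K h * idem zeta mu 0.
    have := idM 0 0; rewrite eqxx scale1r /corner.
    move: (idem zeta mu 0) (gelt K g) (gelt K h) => e x y idM0.
    have -> : e * x * e * (e * y * e) = e * x * (e * e) * (y * e) by rewrite
      !mulrA.
    by rewrite idM0 !mulrA.
  rewrite -class_trace_mulC; last exact: supported_idem.
  have -> : idem zeta mu 0 *
      (idem zeta mu 0 * gelt K g * idem zeta mu 0 * gelt K h) =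
      (p ^ 2)%:R^-1 *: \sum_k idem zeta mu 0 * gelt K (g * mu k * h)%g.
    have idM0 := idM 0 0; rewrite eqxx scale1r in idM0.
    have idem0E : idem zeta mu 0 = (p ^ 2)%:R^-1 *: \sum_k gelt K (mu k).
      congr (_ *: _); apply: eq_bigr => k _.
      by rewrite pairingC pairing0r oppr0 addchar0 scale1r.
    rewrite !mulrA idM0 {2}idem0E; move: (idem zeta mu 0) => e.
    rewrite -scalerAr -scalerAl; congr (_ *: _); rewrite mulr_sumr mulr_suml.
    by apply: eq_bigr => k _; rewrite -!mulrA !geltM mulgA.
  rewrite class_traceZ class_trace_sum [in RHS]exchange_big; congr (_ * _).
  rewrite mulr_sumr; apply: eq_bigr => k _.
  rewrite class_trace_idem_gelt; congr (_ * _).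
  by apply: eq_bigr => j _; rewrite !mulgA.
rewrite class_trace_idem_gelt divff;
  last exact: addchar_neq0 p_prime prim_zeta _.
move: (\sum_j _) (\sum_j _) (p ^ 2)%:R p2K => A B P P0.
by field.
Qed.
End HopfOrder.

(** * Identification with a twist by a cocycle on the character group *)

Section ElementaryAbelianTwist.
Variables (K : fieldType) (p : nat) (zeta : K) (G : finGroupType).
Hypotheses (p_prime : prime p) (prim_zeta : p.-primitive_root zeta).
Hypothesis pK : p%:R != 0 :> K.
Local Notation I := ('F_p * 'F_p)%type.
Variable mu : I -> G.
Hypothesis muD : forall i j, mu (i + j) = (mu i * mu j)%g.
Hypothesis mu_inj : injective mu.
Local Notation z := (@addchar K p zeta).

Fact mu_group_set : group_set [set mu i | i : I].
Proof.
apply/group_setP; split=> [|_ _ /imsetP[i _ ->] /imsetP[j _ ->]].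
  by rewrite -(mu0 muD) imset_f.
by rewrite -muD imset_f.
Qed.
Definition mu_group := Group mu_group_set.
Local Notation M := mu_group.

Lemma mem_mu i : mu i \in M. Proof. exact: imset_f. Qed.

Lemma abelian_mu : abelian M.
Proof.
apply/centsP=> _ /imsetP[i _ ->] _ /imsetP[j _ ->].
by rewrite /commute -!muD addrC.
Qed.

Lemma card_mu : #|M| = (p ^ 2)%N.
Proof. by rewrite card_imset // card_prod !card_Fp // mulnn. Qed.

Definition smu i : subg_of M := subg M (mu i).
(** Inverse of [smu]; the default [0] is never reached, since [M] is the image of [mu]. *)
Definition mulog (x : subg_of M) : I := odflt 0 [pick i | mu i == sgval x].

Lemma sgval_smu i : sgval (smu i) = mu i.
Proof. by rewrite subgK ?mem_mu. Qed.

Lemma smuK : cancel smu mulog.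
Proof.
move=> i; rewrite /mulog; case: pickP => [j|/(_ i)]; rewrite sgval_smu ?eqxx //.
by move/eqP/mu_inj.
Qed.

Lemma mulogK : cancel mulog smu.
Proof.
move=> x; have /imsetP[i _ xi] := subgP x.
have -> : x = smu i by apply: val_inj; rewrite /= sgval_smu.
by rewrite smuK.
Qed.

Lemma smuD i j : smu (i + j) = (smu i * smu j)%g.
Proof. by apply: val_inj; rewrite /= !sgval_smu muD. Qed.

Lemma smu0 : smu 0 = 1%g.
Proof. by apply: val_inj; rewrite /= sgval_smu (mu0 muD). Qed.

Lemma mulogM x y : mulog (x * y)%g = mulog x + mulog y.
Proof. by apply: (can_inj smuK); rewrite smuD !mulogK. Qed.

Lemma sum_smu (W : nmodType) (F : subg_of M -> W) : \sum_x F x = \sum_i F (smu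
  i).
Proof. by rewrite (reindex smu) //; exists mulog => x _;
  [apply: smuK | apply: mulogK]. Qed.

Fact charI_subproof i : is_char [ffun x => z (pairing i (mulog x))].
Proof.
apply/is_charP; split=> [x|x y]; rewrite !ffunE;
  first exact: addchar_neq0 prim_zeta _.
by rewrite mulogM pairingDr (addcharD p_prime prim_zeta).
Qed.
Definition charI i : chargroup K (subg_of M) := Sub _ (charI_subproof i).

Lemma char_val_charI i j : char_val (charI i) (smu j) = z (pairing i j).
Proof. by rewrite /char_val SubK ffunE smuK. Qed.

Lemma charI_inj : injective charI.
Proof.
move=> i j ij; have zij k : z (pairing i k) = z (pairing j k).
  by rewrite -!char_val_charI ij.
have {zij} ij0 k : pairing (i - j) k = 0.
  apply/eqP; rewrite -(addchar_eq1 p_prime prim_zeta) pairingDl pairingNl.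
  rewrite (addcharD p_prime prim_zeta) (addcharN p_prime prim_zeta) zij.
  by rewrite divff // (addchar_neq0 p_prime prim_zeta).
have := (ij0 (1, 0), ij0 (0, 1)); rewrite /pairing /= !mulr1 !mulr0 addr0 add0r.
case=> /eqP + /eqP; rewrite !subr_eq0 => /eqP e1 /eqP e2.
by case: i j e1 e2 {ij ij0} => [? ?] [? ?] /= -> ->.
Qed.

(** Character values here are [p]th roots of unity, hence powers of [zeta]; the exponents at
    [(1, 0)] and [(0, 1)] are the two coordinates of the index. *)
Lemma charI_surj f : exists i, f = charI i.
Proof.
have /is_charP[f_neq0 fM] := valP f.
pose F i := val f (smu i).
have FD i j : F (i + j) = F i * F j by rewrite /F smuD fM.
have F0 : F 0 = 1.
  by apply: (mulfI (f_neq0 (smu 0))); rewrite mulr1 -[_ * F 0]FD addr0.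
have FMn i n : F (i *+ n) = F i ^+ n.
  by elim: n => // n IHn; rewrite mulrS exprS FD IHn.
have fstMn (i : I) n : (i *+ n).1 = i.1 *+ n.
  by elim: n => // n IHn; rewrite !mulrS /= IHn.
have sndMn (i : I) n : (i *+ n).2 = i.2 *+ n.
  by elim: n => // n IHn; rewrite !mulrS /= IHn.
have pI (i : I) : i *+ p = 0.
  apply/eqP; rewrite -pair_eqE /= fstMn sndMn.
  by rewrite !(mulrn_pchar (pchar_Fp p_prime)) !eqxx.
have Fz i : exists k : 'F_p, F i = z k.
  have /(prim_rootP prim_zeta)[k Fk] : F i ^+ p = 1 by rewrite -FMn pI.
  exists k%:R; rewrite Fk /addchar val_Fp_nat //.
  by rewrite (prim_expr_mod prim_zeta).
have zMn a n : z a ^+ n = z (a *+ n).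
  elim: n => [|n IHn]; first by rewrite expr0 mulr0n addchar0.
  by rewrite exprS mulrS (addcharD p_prime prim_zeta) IHn.
have [a Fa] := Fz (1, 0); have [b Fb] := Fz (0, 1).
exists (a, b); apply/val_inj/ffunP=> x;
  rewrite -[x]mulogK -/(F _) /= ffunE smuK.
move: (mulog x) => [c d].
have -> : (c, d) = (1, 0) *+ c + (0, 1) *+ d :> I.
  apply/eqP; rewrite -pair_eqE /= !fstMn !sndMn /= !mul0rn addr0 add0r.
  by rewrite !natr_Zp !eqxx.
rewrite FD !FMn Fa Fb !zMn -(addcharD p_prime prim_zeta) /pairing /=.
rewrite !fstMn !sndMn /= !mul0rn addr0 add0r.
by congr (z (_ + _)); rewrite -mulr_natr.
Qed.

Definition charlog f : I := odflt 0 [pick i | f == charI i].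

Lemma charIK : cancel charI charlog.
Proof.
move=> i; rewrite /charlog; case: pickP => [j|/(_ i)]; rewrite ?eqxx //.
by move/eqP/charI_inj.
Qed.

Lemma charlogK : cancel charlog charI.
Proof. by move=> f; have [i ->] := charI_surj f; rewrite charIK. Qed.

Lemma charID i j : charI (i + j) = (charI i * charI j)%g.
Proof.
apply/val_inj/ffunP=> x; rewrite !ffunE.
by rewrite pairingDl (addcharD p_prime prim_zeta).
Qed.

Lemma charlogM f g : charlog (f * g)%g = charlog f + charlog g.
Proof. by apply: (can_inj charIK); rewrite charID !charlogK. Qed.

Lemma charlog1 : charlog 1%g = 0.
Proof. by apply: (addIr (charlog 1%g)); rewrite -charlogM mulg1 add0r. Qed.

Definition mu_cocycle f g := bichar zeta (charlog f) (charlog g).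

Lemma mu_cocycle_normalized : normalized_2cocycle mu_cocycle.
Proof.
rewrite /mu_cocycle /bichar; split=> [f g|f|f g h].
- exact: addchar_neq0 prim_zeta _.
- by rewrite charlog1 mulr0 mul0r.
- rewrite !charlogM /= -!(addcharD p_prime prim_zeta).
  by congr (z _); ring.
Qed.

(** [chargroup] is not declared finite, so [twist] sums over a classical set; the list of all
    [charI i] enumerates that set without repetition. *)
Lemma sum_charI (W : nmodType) (F : chargroup K (subg_of M) -> W) :
  \sum_(f \in [set: chargroup K (subg_of M)]%classic) F f = \sum_i F (charI i).
Proof.
rewrite (@fsbigE _ _ _ _ _ [seq charI i | i <- enum {: I}]) //=.
- rewrite big_map big_enum_cond /=; apply: eq_bigl => i.
  by apply/asboolP.
- by rewrite map_inj_uniq ?enum_uniq //; apply: charI_inj.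
- move=> f _; have [i ->] := charI_surj f.
  by rewrite map_f ?mem_enum.
Qed.

Lemma char_idemE i : char_idem (charI i) = idem zeta mu i.
Proof.
rewrite /char_idem card_mu; congr (_ *: _).
rewrite sum_smu (reindex_inj (@oppr_inj _ : injective (fun i : I => - i))) /=.
rewrite [RHS](reindex_inj (@oppr_inj _ : injective (fun i : I => - i))) /=.
apply: eq_bigr => j _; rewrite sgval_smu; congr (_ *: _).
have -> : (smu (- j))^-1%g = smu j.
  by apply/eqP; rewrite eq_invg_mul -smuD addNr smu0.
by rewrite char_val_charI pairingNr opprK.
Qed.

Lemma twistE : twist mu_cocycle = bitwist zeta mu.
Proof.
rewrite /twist sum_charI; apply: eq_bigr => i _; rewrite sum_charI.
by apply: eq_bigr => j _; rewrite !char_idemE /mu_cocycle !charIK.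
Qed.

(** [bitwistV] is a two-sided inverse of the twist, so the ring inverse in [twisted_comul] is
    genuine and equals it. *)
Lemma twisted_comulE a : twisted_comul mu_cocycle a = bicomul zeta mu a.
Proof.
rewrite /twisted_comul twistE /bicomul; congr (_ * _).
have Vr := bitwistVr p_prime prim_zeta pK muD.
have Vl := bitwistVl p_prime prim_zeta pK muD.
have Ub : bitwist zeta mu \is a GRing.unit by apply/unitrP;
  exists (bitwistV zeta mu).
by apply: (mulrI Ub); rewrite divrr // Vr.
Qed.

(** The finite Fourier transform on [M] is an isomorphism onto the functions on its characters;
    orthogonality provides the inverse, as [p] is invertible in [K]. *)
Lemma split_mu : split_algebra (group_algebra K (subg_of M)).
Proof.
have p2K : (p ^ 2)%:R != 0 :> K by rewrite natrX expf_neq0.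
pose n := #|{: I}|.
pose F (a : group_algebra K (subg_of M)) : {ffun 'I_n -> K^o} :=
  [ffun t => \sum_i a (smu i) * z (pairing (enum_val t) i)].
have F_lin : linear F.
  move=> k a b; apply/ffunP=> t; rewrite !ffunE scaler_sumr -big_split /=.
  by apply: eq_bigr => i _; rewrite !ffunE mulrDl; congr (_ + _);
    apply: esym (mulrA _ _ _).
pose FL : {linear group_algebra K (subg_of M) -> {ffun 'I_n -> K^o}} :=
  HB.pack F (GRing.isLinear.Build _ _ _ _ F F_lin).
exists n, FL; split.
- apply/ffunP=> t; rewrite !ffunE (bigD1 (0 : I)) //= big1 => [|i i0].
    by rewrite ffunE smu0 eqxx pairing0r addr0 addchar0 mulr1.
  rewrite ffunE -smu0; case: eqP => [/(can_inj smuK) ii|_];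
    last by rewrite mul0r.
  by rewrite ii eqxx in i0.
- move=> a b; apply/ffunP=> t; rewrite !ffunE [RHS]mulr_suml.
  under eq_bigr do rewrite ffunE sum_smu mulr_suml.
  under [RHS]eq_bigr do rewrite mulr_sumr.
  rewrite exchange_big /=; apply: eq_bigr => i _.
  rewrite (reindex_inj (addrI i)) /=; apply: eq_bigr => j _.
  rewrite smuD mulKg pairingDr (addcharD p_prime prim_zeta).
  by rewrite mulrACA.
pose Ginv (c : {ffun 'I_n -> K^o}) : group_algebra K (subg_of M) :=
  [ffun x => (p ^ 2)%:R^-1 * \sum_i c (enum_rank i) * z (- pairing i (mulog
    x))].
exists Ginv => [a|c]; apply/ffunP=> x; rewrite !ffunE.
  transitivity ((p ^ 2)%:R^-1 * \sum_i \sum_j a (smu j) * z (pairing i (j -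
    mulog x))).
    congr (_ * _); apply: eq_bigr => i _; rewrite ffunE enum_rankK mulr_suml.
    apply: eq_bigr => j _; rewrite -mulrA -(addcharD p_prime prim_zeta).
    by rewrite pairingDr pairingNr.
  have orth j : \sum_i z (pairing i (j - mulog x)) =
      if j == mulog x then (p ^ 2)%:R else 0.
    under eq_bigr do rewrite pairingC.
    by rewrite (addchar_orthogonal p_prime prim_zeta) subr_eq0.
  rewrite exchange_big (bigD1 (mulog x)) //= -mulr_sumr orth eqxx big1 =>
    [|j jx].
    by rewrite addr0 mulogK mulrCA mulVf ?mulr1.
  by rewrite -mulr_sumr orth (negbTE jx) mulr0.
transitivity ((p ^ 2)%:R^-1 * \sum_i \sum_j
    c (enum_rank j) * z (pairing (enum_val x - j) i)).
  rewrite mulr_sumr; apply: eq_bigr => i _; rewrite ffunE smuK -mulrA mulr_suml.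
  congr (_ * _); apply: eq_bigr => j _;
    rewrite -mulrA -(addcharD p_prime prim_zeta).
  by rewrite addrC -pairingNl -pairingDl.
rewrite exchange_big (bigD1 (enum_val x)) //= -mulr_sumr.
rewrite (addchar_orthogonal p_prime prim_zeta) subrr eqxx big1 ?addr0 =>
  [|j jx].
  by rewrite enum_valK mulrCA mulVf ?mulr1.
rewrite -mulr_sumr (addchar_orthogonal p_prime prim_zeta) subr_eq0.
by rewrite eq_sym (negbTE jx) mulr0.
Qed.
End ElementaryAbelianTwist.

(** * A divisibility that a Hopf order entails *)

Section Criterion.
Variables (K : fieldExtType rat) (p : nat) (zeta : K) (G : finGroupType).
Hypotheses (p_prime : prime p) (prim_zeta : p.-primitive_root zeta).
Local Notation I := ('F_p * 'F_p)%type.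
Variable mu : I -> G.
Hypothesis muD : forall i j, mu (i + j) = (mu i * mu j)%g.
Hypothesis mu_inj : injective mu.
Local Notation R := (ring_of_integers K).

Hypothesis hopf_order : admits_hopf_order R
  (twisted_group_algebra (mu_cocycle p_prime prim_zeta (muD := muD) mu_inj)).
Variable L : {group G}.
Hypothesis muL : forall i, mu i \in L.

(** A dual basis of the order provides the lattice hypotheses, with [twisted_comul] rewritten as
    [bicomul]; the trace is then replaced by its explicit value. *)
Lemma integral_trace_product (a b g h : G) :
    a \in L -> b \in L -> g \in L -> h \in L ->
  (\sum_j class_trace L a (gelt K (mu j * g)%g)) *
  (\sum_j \sum_k class_trace L b (gelt K (mu j * g * mu k * h)%g)) / (p ^ 2)%:R
    \in R.
Proof.
move=> aL bL gL hL.
have [X [[fgX projX] tensX [_ mulX] comulX _]] := hopf_order.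
have [N [v [phi [vX phiX dual_v]]]] := dual_basis fgX projX tensX.
rewrite -(corner_trace p_prime prim_zeta muD muL a b g h).
apply: (integral_corner_trace p_prime prim_zeta muD
  (X := [pred x | x \in X]) (v := v) (phi := phi)) => //.
- move=> r rR.
  pose c i : subring R := Sub (r i) (rR i).
  have : \sum_i c i *: (v i : restrict_scalars R (group_algebra K G)) \in X.
    by apply: rpred_sum => i _; apply: rpredZ; apply: vX.
  by [].
- move=> u /comulX[n [x [y [xX yX E]]]]; exists n, x, y; split=> //.
  rewrite -(twisted_comulE p_prime prim_zeta (prime_natr_neq0 K p_prime) muD
    mu_inj).
  exact: E.
Qed.

(** On group elements the class traces are counts, so summing [integral_trace_product] over pairs
    from the family shows that a natural number divided by [p ^ 2] is integral. The family [a]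
    permits class functions supported on several classes of [L]. *)
Lemma dvdn_conjugate_count (D : finType) (a : D -> G) (g h : G) :
    (forall d, a d \in L) -> g \in L -> h \in L ->
  (p ^ 2 %|
    (\sum_d \sum_j #|[set s in L | (s * a d * s^-1)%g == (mu j * g)%g]|) *
    (\sum_d \sum_j \sum_k
       #|[set s in L | (s * a d * s^-1)%g == (mu j * g * mu k * h)%g]|))%N.
Proof.
move=> aL gL hL; apply: (@dvdn_integral K); first by rewrite expn_gt0 prime_gt0.
rewrite natrM !natr_sum mulr_suml mulr_suml; apply: rpred_sum => d _.
rewrite mulr_sumr mulr_suml; apply: rpred_sum => e _.
apply: etrans (integral_trace_product (aL d) (aL e) gL hL).
congr (_ * _ / _ \in R).
  by rewrite natr_sum; apply: eq_bigr => j _; rewrite class_trace_gelt.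
rewrite natr_sum; apply: eq_bigr => j _; rewrite natr_sum.
by apply: eq_bigr => k _; rewrite class_trace_gelt.
Qed.
End Criterion.

(** * Explicit matrices of size three *)

Local Notation o0 := (@Ordinal 3 0 isT).
Local Notation o1 := (@Ordinal 3 1 isT).
Local Notation o2 := (@Ordinal 3 2 isT).

Lemma ord3_cases (P : 'I_3 -> Prop) : P o0 -> P o1 -> P o2 -> forall i, P i.
Proof.
by move=> P0 P1 P2 [[|[|[|//]]] lti]; rewrite (bool_irrelevance lti isT).
Qed.

Lemma sum_ord3 (V : nmodType) (f : 'I_3 -> V) : \sum_i f i = f o0 + f o1 + f o2.
Proof.
rewrite !big_ord_recl big_ord0 addr0 addrA.
by congr (f _ + f _ + f _); apply: val_inj.
Qed.

Lemma det_mx3 (R : comNzRingType) (A : 'M[R]_3) :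
  \det A = A o0 o0 * (A o1 o1 * A o2 o2 - A o1 o2 * A o2 o1)
         - A o0 o1 * (A o1 o0 * A o2 o2 - A o1 o2 * A o2 o0)
         + A o0 o2 * (A o1 o0 * A o2 o1 - A o1 o1 * A o2 o0).
Proof.
(* Entries are read through natural number indices, so that the ordinals from nested cofactor
   expansions compute. *)
pose f i j := A (inord i) (inord j).
have fE i j : A i j = f i j by rewrite /f !inord_val.
rewrite !fE /=; have -> : A = \matrix_(i, j) f i j by apply/matrixP=> i j;
  rewrite mxE.
rewrite (expand_det_row _ o0) sum_ord3 /cofactor.
rewrite !(expand_det_row _ ord0) !big_ord_recl !big_ord0 /cofactor !det_mx11
  !mxE /=.
rewrite /bump /=; ring.
Qed.

Section CharPoly3.
Variable F : fieldType.
Implicit Types A Y : 'M[F]_3.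

Definition mx3 (a b c d e f g h i : F) : 'M[F]_3 :=
  \matrix_(r, s) nth 0 (nth [::] [:: [:: a; b; c]; [:: d; e; f]; [:: g; h;
    i]] r) s.

(** The sum of the principal minors of size two, which is the linear coefficient of the
    characteristic polynomial. *)
Definition minor2 A : F :=
  A o0 o0 * A o1 o1 - A o0 o1 * A o1 o0 + (A o0 o0 * A o2 o2 - A o0 o2 * A o2
    o0)
  + (A o1 o1 * A o2 o2 - A o1 o2 * A o2 o1).

Definition cubic (s t : F) : {poly F} := 'X^3 - s *: 'X^2 + t *: 'X - 1.

Lemma char_poly_mx3 A : \det A = 1 -> char_poly A = cubic (\tr A) (minor2 A).
Proof.
move=> detA; rewrite /cubic -(polyC1 F) -detA det_mx3 /char_poly det_mx3
  /mxtrace.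
rewrite sum_ord3 /minor2 !mxE /= -!mul_polyC !(rmorphD, rmorphN, rmorphM) /=.
ring.
Qed.

Lemma size_cubic s t : size (cubic s t) = 4.
Proof.
rewrite /cubic -addrA -addrA size_polyDl size_polyXn //.
rewrite (leq_ltn_trans (size_polyD _ _)) // gtn_max size_polyN.
rewrite (leq_ltn_trans (size_scale_leq _ _)) ?size_polyXn //=.
rewrite (leq_ltn_trans (size_polyD _ _)) // gtn_max size_polyN size_poly1 andbT.
by rewrite (leq_ltn_trans (size_scale_leq _ _)) ?size_polyX.
Qed.

Lemma cubic_inj s t s' t' : cubic s t = cubic s' t' -> s = s' /\ t = t'.
Proof.
move=> E; have [E1 E2] := (congr1 (fun q : {poly F} => q`_1) E,
                           congr1 (fun q : {poly F} => q`_2) E).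
move: E1 E2; rewrite /cubic !coefE /= !mulr0 !mulr1 !subr0 !add0r !addr0.
by move=> -> /oppr_inj ->.
Qed.

Lemma horner_cubic s t r : (cubic s t).[r] = r ^+ 3 - s * r ^+ 2 + t * r - 1.
Proof. by rewrite /cubic !hornerE. Qed.

Definition transvection (x : F * F) : 'M[F]_3 := mx3 1 x.1 x.2 0 1 0 0 0 1.
Definition cycle_mx : 'M[F]_3 := mx3 0 0 1 1 0 0 0 1 0.
(** The matrix of multiplication by [X] modulo [cubic s t], in the basis of powers of [X]. *)
Definition companion s t : 'M[F]_3 := mx3 0 0 1 1 0 (- t) 0 1 s.

Lemma det_transvection x : \det (transvection x) = 1.
Proof. rewrite det_mx3 !mxE /=; ring. Qed.

Lemma det_cycle_mx : \det cycle_mx = 1.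
Proof. rewrite det_mx3 !mxE /=; ring. Qed.

Lemma det_companion s t : \det (companion s t) = 1.
Proof. rewrite det_mx3 !mxE /=; ring. Qed.

Lemma char_poly_companion s t : char_poly (companion s t) = cubic s t.
Proof.
rewrite char_poly_mx3 ?det_companion // /minor2 /mxtrace sum_ord3 !mxE /=.
by congr cubic; ring.
Qed.

(** The determinant of [e0, Y e0, Y^2 e0], up to sign. *)
Definition krylov Y : F :=
  Y o1 o0 * (Y o2 o0 * Y o1 o1 - Y o2 o1 * Y o1 o0)
  - Y o2 o0 * (Y o1 o0 * Y o2 o2 - Y o1 o2 * Y o2 o0).

Lemma mulmx3E A Y i j :
  (A *m Y) i j = A i o0 * Y o0 j + A i o1 * Y o1 j + A i o2 * Y o2 j.
Proof. by rewrite mxE sum_ord3. Qed.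

(** A transvection changes only the first row of [Y], which does not enter [krylov]. *)
Lemma krylov_transvection x Y : krylov (transvection x *m Y) = krylov Y.
Proof. rewrite /krylov !mulmx3E !mxE /=; ring. Qed.

Lemma krylovZ c Y : krylov (c *: Y) = c ^+ 3 * krylov Y.
Proof. rewrite /krylov !mxE; ring. Qed.

(** When [krylov Y] vanishes, [e0] lies in a proper subspace stable under [Y]. Either [e0] is an
    eigenvector, or [e0] and [Y e0] span a stable plane and the row vector annihilating it is a left
    eigenvector. *)
Lemma krylov_root Y : \det Y = 1 -> krylov Y = 0 -> exists r,
  root (char_poly Y) r.
Proof.
rewrite /krylov => detY kY0.
have [w0|w_neq0] := boolP ((Y o1 o0 == 0) && (Y o2 o0 == 0)).
  case/andP: w0 => /eqP Y10 /eqP Y20; exists (Y o0 o0).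
  rewrite char_poly_mx3 // rootE horner_cubic -detY det_mx3 /mxtrace sum_ord3.
  by rewrite /minor2 Y10 Y20; apply/eqP; ring.
(* The annihilator has entries [0], [- Y o2 o0], [Y o1 o0]; its eigenvalue is read off the last
   coordinate if that entry is nonzero, otherwise off the middle one. *)
exists (if Y o1 o0 == 0 then Y o1 o1
        else (Y o1 o0 * Y o2 o2 - Y o2 o0 * Y o1 o2) / Y o1 o0).
rewrite -eigenvalue_root_char; apply/eigenvalueP.
exists (\row_j nth 0 [:: 0; - Y o2 o0; Y o1 o0] j); last first.
  apply: contraNneq w_neq0 => /rowP E; move: (E o1) (E o2).
  by rewrite !mxE /= => /eqP; rewrite oppr_eq0 => -> ->; rewrite eqxx.
have [Y10|Y10] := eqVneq (Y o1 o0) 0; last first.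
  apply/rowP; apply: ord3_cases; rewrite !mxE sum_ord3 !mxE /=.
  - by field.
  - apply/eqP; rewrite -subr_eq0; apply/eqP.
    by transitivity (- (Y o1 o0)^-1 * 0); [rewrite -[X in _ = _ * X]kY0;
      field | rewrite mulr0].
  - by field.
have Y20 : Y o2 o0 != 0 by move: w_neq0; rewrite Y10 eqxx.
have Y12 : Y o1 o2 = 0.
  have /eqP : Y o1 o2 * (Y o2 o0 * Y o2 o0) = 0 by rewrite -kY0 Y10; ring.
  by rewrite !mulf_eq0 (negbTE Y20) !orbF => /eqP.
by apply/rowP; apply: ord3_cases; rewrite !mxE sum_ord3 !mxE /= Y10 ?Y12; ring.
Qed.
End CharPoly3.

(** * Counting over a finite field *)

Section FiniteField.
Variable F : finFieldType.
Local Notation q := #|F|.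

(** A root [r] is nonzero because the constant term is [-1], and [r] with [s] determines [t]. So the
    cubics with a root are fewer than all pairs [(s, t)]. *)
Lemma exists_rootless_cubic : exists s t, forall x : F, ~~ root (cubic s t) x.
Proof.
pose f (rs : F * F) : F * F :=
  (rs.2, (1 - rs.1 ^+ 3 + rs.2 * rs.1 ^+ 2) / rs.1).
pose A := [set rs : F * F | rs.1 != 0].
have ltAq : (#|f @: A| < #|{: F * F}|)%N.
  apply: leq_ltn_trans (leq_imset_card f A) _; rewrite -[X in (_ < X)%N]cardsT.
  apply: proper_card; rewrite properE subsetT /=; apply/subsetPn.
  by exists (0, 0); rewrite !inE ?eqxx.
have /subsetPn[[s t] _ stA] : ~~ ([set: F * F] \subset f @: A).
  by apply: contraL ltAq => /subset_leq_card; rewrite cardsT -leqNgt.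
exists s, t => r; apply: contra stA; rewrite rootE horner_cubic => /eqP root_r.
have r_neq0 : r != 0.
  apply: contraPneq root_r => ->; rewrite !expr0n /= !mulr0 subr0 !add0r.
  by apply/eqP; rewrite oppr_eq0 oner_eq0.
apply/imsetP; exists (r, s); rewrite ?inE // /f /=; congr (_, _).
apply: (mulIf r_neq0); rewrite mulfVK //; apply/eqP; rewrite -subr_eq0 -root_r.
by apply/eqP; ring.
Qed.

Section Rootless.
Variables s t : F.
Hypothesis rootless : forall x, ~~ root (cubic s t) x.

(** The trace and [minor2] of the product are affine in the two parameters of the transvection, with
    determinant [krylov Y]. If this vanishes, the characteristic polynomial has a root and cannot be
    the rootless cubic. *)
Lemma card_transvection_cubic Y : \det Y = 1 ->
  #|[set x | char_poly (transvection x *m Y) == cubic s t]| = (krylov Y != 0).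
Proof.
move=> detY; have detuY x : \det (transvection x *m Y) = 1.
  by rewrite det_mulmx det_transvection mul1r.
have [kY0|kY0] := eqVneq (krylov Y) 0.
  apply/eqP; rewrite cards_eq0 -subset0; apply/subsetP=> x;
    rewrite !inE => /eqP cpx.
  have [|r] := @krylov_root _ (transvection x *m Y) (detuY x).
    by rewrite krylov_transvection.
  by rewrite cpx (negbTE (rootless r)).
have eqP2 x : (char_poly (transvection x *m Y) == cubic s t) =
    (x.1 * Y o1 o0 + x.2 * Y o2 o0 == s - \tr Y) &&
    (x.1 * (Y o1 o0 * Y o2 o2 - Y o1 o2 * Y o2 o0) +
     x.2 * (Y o2 o0 * Y o1 o1 - Y o2 o1 * Y o1 o0) == t - minor2 Y).
  rewrite char_poly_mx3 //.
  have -> : \tr (transvection x *m Y) = \tr Y + (x.1 * Y o1 o0 + x.2 * Y o2 o0).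
    by rewrite /mxtrace !sum_ord3 !mulmx3E !mxE /=; ring.
  have -> : minor2 (transvection x *m Y) = minor2 Y +
      (x.1 * (Y o1 o0 * Y o2 o2 - Y o1 o2 * Y o2 o0) +
       x.2 * (Y o2 o0 * Y o1 o1 - Y o2 o1 * Y o1 o0)).
    by rewrite /minor2 !mulmx3E !mxE /=; ring.
  have eqB (a b c : F) : (c == a - b) = (b + c == a).
    by rewrite eq_sym subr_eq eq_sym addrC.
  rewrite !eqB.
  by apply/eqP/andP=> [/cubic_inj[-> ->]|[/eqP-> /eqP->]].
move: kY0 eqP2; rewrite /krylov.
move: (Y o1 o0) (Y o2 o0) (Y o1 o0 * _ - _) (Y o2 o0 * _ - _) =>
  a b c d k0 eqP2.
pose u := s - \tr Y; pose v := t - minor2 Y.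
(* The unique solution by Cramer's rule. *)
apply/eqP/cards1P; exists ((u * d - b * v) / (a * d - b * c),
  (a * v - u * c) / (a * d - b * c)).
apply/setP=> -[x y]; rewrite !inE eqP2 /= -/u -/v.
apply/andP/eqP=> [[/eqP<- /eqP<-]|[-> ->]]; first by congr (_, _); field.
by split; apply/eqP; field.
Qed.

(** An intertwiner is determined by its first column [w], the others being [y w] and [y ^ 2 w]. For
    [y] with the irreducible characteristic polynomial every nonzero [w] gives an invertible matrix;
    otherwise none exists, as similar matrices share it. *)
Lemma card_intertwiners y :
  #|[set z : 'M[F]_3 | (z \in unitmx) && (z *m companion s t == y *m z)]| =
  if char_poly y == cubic s t then (q ^ 3).-1 else 0%N.
Proof.
case: eqP => [cpy|ncpy]; last first.
  apply/eqP; rewrite cards_eq0 -subset0; apply/subsetP=> z; rewrite !inE.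
  case/andP=> uz /eqP zE; case: ncpy; rewrite -(char_poly_companion s t).
  have zX_neq0 : \det (map_mx polyC z) != 0.
    by rewrite det_map_mx polyC_eq0 -unitfE -unitmxE.
  apply: (mulIf zX_neq0); rewrite [RHS]mulrC /char_poly -!det_mulmx;
    congr (\det _).
  rewrite /char_poly_mx mulmxBl mulmxBr -!map_mxM zE.
  by rewrite scalar_mxC.
pose Z (w : 'cV[F]_3) : 'M[F]_3 := \matrix_(i, j) (y ^+ j *m w) i 0.
have zc0 (z : 'M[F]_3) i : (z *m companion s t) i o0 = z i o1.
  by rewrite mulmx3E !mxE /=; ring.
have zc1 (z : 'M[F]_3) i : (z *m companion s t) i o1 = z i o2.
  by rewrite mulmx3E !mxE /=; ring.
have zc2 (z : 'M[F]_3) i :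
    (z *m companion s t) i o2 = z i o0 - t * z i o1 + s * z i o2.
  by rewrite mulmx3E !mxE /=; ring.
have ZE w i j : Z w i j = (y ^+ j *m w) i 0 by rewrite mxE.
have col_Z w : col o0 (Z w) = w.
  by apply/colP=> i; rewrite 2!mxE expr0 -idmxE mul1mx.
have y3 : y ^+ 3 = s *: y ^+ 2 - t *: y + 1.
  have := Cayley_Hamilton y; rewrite cpy /cubic !(rmorphB, rmorphD) rmorphXn /=.
  rewrite horner_mx_X !horner_mxZ rmorphXn /= !horner_mx_X rmorph1.
  move/eqP; rewrite subr_eq0 (can2_eq (addrK _) (subrK _)) subr_eq => /eqP->.
  by rewrite addrC [1 + _]addrC addrA.
have -> : [set z : 'M[F]_3 | (z \in unitmx) && (z *m companion s t == y *m z)] =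
    Z @: [set~ 0].
  apply/setP=> z; rewrite inE; apply/andP/imsetP=> [[uz /eqP zE]|[w]].
    exists (col o0 z).
      rewrite !inE; apply: contraTneq uz => z0; rewrite unitmxE unitfE.
      rewrite (expand_det_col _ o0) big1 ?eqxx // => i _.
      by have /colP/(_ i) := z0; rewrite !mxE => ->; rewrite mul0r.
    have z1 i : z i o1 = (y *m col o0 z) i 0.
      by rewrite -zc0 zE !mxE; apply: eq_bigr => k _; rewrite mxE.
    have z2 i : z i o2 = (y ^+ 2 *m col o0 z) i 0.
      rewrite -zc1 zE expr2 -mulmxE -mulmxA mxE [RHS]mxE.
      by apply: eq_bigr => k _; rewrite z1.
    apply/matrixP=> i; apply: ord3_cases; rewrite [RHS]mxE //=.
      by rewrite expr0 -idmxE mul1mx mxE.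
  rewrite !inE => w0 ->; split; last first.
    have Zy i j : (y *m Z w) i j = (y ^+ j.+1 *m w) i 0.
      rewrite exprS -mulmxE -mulmxA mxE [RHS]mxE.
      by apply: eq_bigr => k _; rewrite mxE.
    apply/eqP/matrixP=> i; apply: ord3_cases; rewrite Zy ?zc0 ?zc1 ?zc2 !ZE //=.
    rewrite y3 !mulmxDl mulNmx -!scalemxAl expr0 -idmxE !mul1mx expr1.
    have mxD (A B : 'cV[F]_3) : (A + B) i 0 = A i 0 + B i 0 by rewrite mxE.
    have mxN (A : 'cV[F]_3) : (- A) i 0 = - A i 0 by rewrite mxE.
    have mxZ c (A : 'cV[F]_3) : (c *: A) i 0 = c * A i 0 by rewrite mxE.
    rewrite !(mxD, mxN, mxZ).
    by ring.
  rewrite unitmxE unitfE -det_tr; apply/det0P=> -[v v0 vZ].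
  (* A dependence among the columns says [f(y) w = 0] with [f] nonzero of degree below 3. A Bezout
     relation between [f] and the irreducible cubic, which kills [y], then gives [w = 0]. *)
  pose f := \poly_(j < 3) v 0 (inord j).
  have f_w0 : horner_mx y f *m w = 0.
    rewrite /f poly_def rmorph_sum /= mulmx_suml.
    apply/colP=> i; have /rowP/(_ i) := vZ; rewrite !mxE => <-.
    rewrite summxE; apply: eq_bigr => j _;
      rewrite inord_val horner_mxZ rmorphXn /=.
    by rewrite horner_mx_X -scalemxAl !mxE.
  have cop : coprimep (cubic s t) f.
    rewrite irreducible_poly_coprime; last first.
      by apply: cubic_irreducible rootless; rewrite size_cubic.
    apply/negP=> /dvdp_leq; rewrite size_cubic leqNgt ltnS size_poly => f_neq0.
    case/eqP: v0; apply/rowP=> j; rewrite mxE; apply/eqP; apply: contraT => vj0.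
    have /f_neq0 // : f != 0.
    by apply: contraNneq vj0 => /polyP/(_ j);
      rewrite coef_poly ltn_ord inord_val coef0 => ->.
  case/Bezout_eq1_coprimepP: cop => -[a b] /= ab1.
  case/eqP: w0; have e1 : 1%:M = horner_mx y (a * cubic s t + b * f) by rewrite
    ab1 horner_mx_C.
  rewrite -[w]mul1mx e1 rmorphD !rmorphM /=.
  rewrite -{1}cpy Cayley_Hamilton mulr0 add0r -mulmxE -mulmxA f_w0 mulmx0.
  by [].
rewrite card_in_imset => [|w w' _ _ ww']; last by rewrite -(col_Z w) ww' col_Z.
by rewrite cardsC1 card_mx muln1.
Qed.
End Rootless.

(** Here [krylov] equals [x.1 * x.2 + 1], which vanishes on a hyperbola with [q - 1] points. *)
Lemma card_krylov_cycle :
  (#|[set x : F * F | krylov (cycle_mx F *m transvection x *m cycle_mx F) !=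
    0%R]| + q.-1
   = q ^ 2)%N.
Proof.
have kE x : krylov (cycle_mx F *m transvection x *m cycle_mx F) = x.1 * x.2 + 1.
  by rewrite /krylov !mulmx3E !mxE /=; ring.
pose f (x : F) := (x, - x^-1).
have -> : q.-1 = #|f @: [set~ 0%R]|.
  by rewrite card_imset ?cardsC1 // => x y [].
rewrite -[in RHS]mulnn -[in RHS]card_prod -[in RHS]cardsT -(cardsID (f @: [set~
  0%R]) setT) addnC; congr (_ + _)%N.
  by rewrite setTI.
apply: eq_card => -[x y]; rewrite !inE kE /= andbT; congr (~~ _).
apply/eqP/imsetP=> [xy|[a]]; last first.
  rewrite !inE => a0 [-> ->]; rewrite mulrN divff // addNr //.
have x0 : x != 0 by apply: contra_eq_neq xy => ->; rewrite mul0r add0r oner_eq0.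
exists x; rewrite ?inE // /f; congr (_, _); apply: (mulfI x0).
by rewrite mulrN divff //; apply/eqP; rewrite -addr_eq0 xy.
Qed.
End FiniteField.

(** * Conjugation counts in a projective image of the special linear group *)

Section ProjectiveCount.
Variables (F : finFieldType) (G : finGroupType) (Phi : 'M[F]_3 -> G).
Hypothesis PhiM : forall A B, \det A = 1 -> \det B = 1 ->
  Phi (A *m B) = (Phi A * Phi B)%g.
Hypothesis Phi_scalar : forall A B, \det A = 1 -> \det B = 1 ->
  Phi A = Phi B -> exists c, A = c *: B.
Local Notation q := #|F|.

Definition sl3 := [set A : 'M[F]_3 | \det A == 1].

Lemma Phi1 : Phi 1%:M = 1%g.
Proof. by apply: (mulgI (Phi 1%:M)); rewrite -PhiM ?det1 // mul1mx mulg1. Qed.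

Fact Phi_group_set : group_set (Phi @: sl3).
Proof.
apply/group_setP; split=> [|_ _ /imsetP[A + ->] /imsetP[B + ->]].
  by rewrite -Phi1 imset_f // inE det1.
rewrite !inE => /eqP dA /eqP dB; rewrite -PhiM // imset_f // inE.
by rewrite det_mulmx dA dB mulr1.
Qed.
Definition Phi_group := Group Phi_group_set.
Local Notation L := Phi_group.

Lemma mem_Phi A : \det A = 1 -> Phi A \in L.
Proof. by move=> dA; apply: imset_f; rewrite inE dA. Qed.

(** The kernel of [Phi] on [sl3], indexed by the scalar. *)
Definition kernel_scalars := [set c : F | (c ^+ 3 == 1) && (Phi c%:M == 1%g)].
Local Notation kappa := kernel_scalars.

Lemma kernel_scalars_gt0 : (0 < #|kappa|)%N.
Proof. by apply/card_gt0P; exists 1; rewrite inE expr1n Phi1 !eqxx. Qed.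

(** Since [B] is nonzero, at most one scalar satisfies the matrix equality. Equalities in [G] thus
    become sums of matrix equalities, which can be counted. *)
Lemma eq_Phi A B : \det A = 1 -> \det B = 1 ->
  ((Phi A == Phi B : nat) = \sum_(c in kappa) (A == (c *: B)%R))%N.
Proof.
move=> dA dB; have dZ c : \det (c *: B) = c ^+ 3 by rewrite detZ dB mulr1.
have PhiZ c : c ^+ 3 = 1 -> Phi (c *: B) = (Phi c%:M * Phi B)%g.
  by move=> c3; rewrite -mul_scalar_mx PhiM // det_scalar.
case: eqP => [PhiAB|nAB]; last first.
  rewrite big1 // => c; rewrite inE => /andP[/eqP c3 /eqP Phic];
    case: eqP => // AE.
  by case: nAB; rewrite AE PhiZ // Phic mul1g.
have [c AE] := Phi_scalar dA dB PhiAB.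
have c3 : c ^+ 3 = 1 by rewrite -dZ -AE.
have B_neq0 : B != 0 by apply: contra_eq_neq dB => ->;
  rewrite det0 eq_sym oner_neq0.
have c_kappa : c \in kappa.
  rewrite inE c3 eqxx; apply/eqP/(mulIg (Phi B)).
  by rewrite mul1g -PhiZ // -AE PhiAB.
rewrite (bigD1 c) //= AE eqxx big1 // => e /andP[_ ec].
case: eqP => // /eqP; rewrite -subr_eq0 -scalerBl scaler_eq0 subr_eq0.
by rewrite (negbTE B_neq0) orbF eq_sym (negbTE ec).
Qed.

Lemma card_Phi_fiber (P : pred G) :
  (#|[set l in L | P l]| * #|kappa| = #|[set A in sl3 | P (Phi A)]|)%N.
Proof.
rewrite -!sum1_card big_distrl /=.
rewrite [RHS](partition_big Phi (fun l => l \in [set l in L | P l])) /=;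
  last first.
  by move=> A; rewrite !inE => /andP[/eqP dA PA]; rewrite mem_Phi.
apply: eq_bigr => l; rewrite inE => /andP[/imsetP[B]];
  rewrite inE => /eqP dB -> PB.
rewrite mul1n.
transitivity (\sum_(A in sl3) (Phi A == Phi B))%N; last first.
  rewrite [RHS]big_mkcond [LHS]big_mkcond; apply: eq_bigr => A _; rewrite !inE.
  by case: (_ == 1) => //=; case: eqP => [->|]; rewrite ?PB ?andbF.
rewrite (eq_bigr (fun A => \sum_(c in kappa) (A == (c *: B)%R))%N); last first.
  by move=> A; rewrite inE => /eqP dA; apply: eq_Phi.
rewrite exchange_big /=; apply: eq_bigr => c; rewrite inE => /andP[/eqP c3 _].
rewrite (bigD1 (c *: B)) /=; last by rewrite inE detZ c3 dB mulr1.
by rewrite eqxx big1 // => A /andP[_ /negbTE->].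
Qed.

(** For [d] nonzero, coset representatives of [sl3] in the invertible matrices, one for each
    determinant. *)
Definition scale_first (d : F) : 'M[F]_3 := mx3 d 0 0 0 1 0 0 0 1.

Lemma det_scale_first d : \det (scale_first d) = d.
Proof. rewrite det_mx3 !mxE /=; ring. Qed.

Lemma scale_firstV d : d != 0 -> scale_first d *m scale_first d^-1 = 1%:M.
Proof.
move=> d0; apply/matrixP; apply: ord3_cases; apply: ord3_cases;
  by rewrite mulmx3E !mxE /=; field.
Qed.

Lemma scale_firstVl d : d != 0 -> scale_first d^-1 *m scale_first d = 1%:M.
Proof. by move=> d0; rewrite -{2}[d]invrK scale_firstV // invr_eq0. Qed.

Local Notation units := {d : F | d != 0}.

Lemma sum_unitmx3 (f : 'M[F]_3 -> nat) :
  (\sum_(z | z \in unitmx) f z =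
   \sum_(d : units) \sum_(A in sl3) f (A *m scale_first (val d)))%N.
Proof.
have one_neq0 : (1 : F) != 0 by apply: oner_neq0.
pose dt (z : 'M[F]_3) : units := insubd (Sub 1 one_neq0) (\det z).
rewrite (partition_big dt xpredT) //=; apply: eq_bigr => d _.
have d0 := valP d.
rewrite (reindex_onto (fun A => A *m scale_first (val d))
                      (fun z => z *m scale_first (val d)^-1)) /=; last first.
  by move=> z _; rewrite -mulmxA scale_firstVl // mulmx1.
apply: eq_bigl => A; rewrite -mulmxA scale_firstV // mulmx1 eqxx andbT inE.
rewrite unitmxE unitfE det_mulmx det_scale_first mulf_eq0 negb_or d0 andbT.
rewrite -val_eqE /dt val_insubd /= det_mulmx det_scale_first mulf_eq0 negb_or
  d0 andbT.
have [->|A0] := eqVneq (\det A) 0; first by rewrite /= eq_sym oner_eq0.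
by rewrite /= -[X in _ == X]mul1r (inj_eq (mulIf d0)).
Qed.

Variables s t : F.
Hypothesis rootless : forall x, ~~ root (cubic s t) x.

(** Conjugation of the companion matrix by all invertible matrices splits into conjugation by [sl3]
    of these matrices, one per coset. *)
Definition companion_conj (d : units) : 'M[F]_3 :=
  scale_first (val d) *m companion s t *m scale_first (val d)^-1.

Lemma det_companion_conj d : \det (companion_conj d) = 1.
Proof.
rewrite !det_mulmx det_companion !det_scale_first mulr1 divff //.
exact: (valP d).
Qed.

(** The factor [#|kappa|] lifts the count to [sl3], and [eq_Phi] turns equality in [G] into
    intertwining of the companion matrix with [c *: y] for [c] in [kappa]. The sum over [d]
    reassembles all invertible intertwiners. *)
Lemma card_Phi_conj y : \det y = 1 ->
  ((\sum_d #|[set l in L | (l * Phi (companion_conj d) * l^-1)%g == Phi y]|) *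
    #|kappa| =
   (q ^ 3).-1 * #|[set c in kappa | char_poly (c *: y)%R == cubic s t]|)%N.
Proof.
move=> dy; rewrite big_distrl /=.
under eq_bigr do rewrite (card_Phi_fiber (fun l => (l * _ * l^-1)%g == _)).
transitivity (\sum_(c in kappa) #|[set z : 'M[F]_3 | (z \in unitmx) &&
    (z *m companion s t == (c *: y) *m z)]|)%N; last first.
  rewrite [RHS]mulnC -sum_nat_const [LHS]big_mkcond [RHS]big_mkcond /=.
  apply: eq_bigr => c _; rewrite [c \in [set _ in _ | _]]inE card_intertwiners
    //.
  by case: (c \in kappa) => //=; case: eqP.
have cardE c : #|[set z : 'M[F]_3 | (z \in unitmx) && (z *m companion s t == (c
  *: y) *m z)]|
   = (\sum_(z | z \in unitmx) (z *m companion s t == (c *: y)%R *m z))%N.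
  by rewrite -sum1_card [LHS]big_mkcond [RHS]big_mkcond /=;
    apply: eq_bigr => z _;
     rewrite inE; case: (z \in unitmx) => //=; case: eqP.
under [RHS]eq_bigr do rewrite cardE sum_unitmx3.
rewrite [RHS]exchange_big /=; apply: eq_bigr => d _.
rewrite [RHS]exchange_big /= -sum1_card [LHS]big_mkcond [RHS]big_mkcond /=.
apply: eq_bigr => A _; rewrite inE; case: (boolP (A \in sl3)) => //=.
rewrite inE => /eqP dA.
transitivity (Phi (A *m companion_conj d) == Phi (y *m A) : nat).
  have eqV (a b c : G) : ((a * b^-1)%g == c) = (a == (c * b)%g).
    by apply/eqP/eqP=> [<-|->]; rewrite ?mulgKV ?mulgK.
  by rewrite (PhiM dA (det_companion_conj d)) (PhiM dy dA) eqV; case: eqP.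
rewrite eq_Phi; first last.
- by rewrite det_mulmx dy dA mulr1.
- by rewrite det_mulmx dA det_companion_conj mulr1.
apply: eq_bigr => c _; congr nat_of_bool.
have D0 := valP d; apply/eqP/eqP=> E.
  rewrite -scalemxAl mulmxA scalemxAl -E /companion_conj !mulmxA.
  by rewrite -[RHS]mulmxA scale_firstVl // mulmx1.
rewrite /companion_conj !mulmxA E -!mulmxA scale_firstV // mulmx1.
by rewrite -scalemxAl.
Qed.

(** Each [c] in [kappa] has cube 1 and leaves [krylov] unchanged, so all scalars contribute equally
    and [#|kappa|] cancels. *)
Lemma card_Phi_transvection y : \det y = 1 ->
  (\sum_d \sum_j
     #|[set l in L | (l * Phi (companion_conj d) * l^-1)%g == (Phi
       (transvection j) * Phi y)%g]| =
   (q ^ 3).-1 * (krylov y != 0%R))%N.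
Proof.
move=> dy; apply/eqP; rewrite -(eqn_pmul2r kernel_scalars_gt0); apply/eqP.
rewrite exchange_big big_distrl /=.
under eq_bigr => j _.
  rewrite -PhiM ?det_transvection // card_Phi_conj; last first.
    by rewrite det_mulmx det_transvection mul1r.
  over.
rewrite -big_distrr /= -mulnA; congr (_ * _)%N.
transitivity (\sum_(c in kappa) (krylov y != 0%R))%N;
  last by rewrite sum_nat_const mulnC.
transitivity (\sum_(c in kappa) #|[set j | char_poly (transvection j *m (c *:
  y)%R) == cubic s t]|)%N.
  have -> : \sum_(j : F * F) #|[set c in kappa |
      char_poly (c *: (transvection j *m y))%R == cubic s t]| =
    (\sum_j \sum_(c in kappa) (char_poly (transvection j *m (c *: y)%R) ==
      cubic s t))%N.
    apply: eq_bigr => j _; rewrite -sum1_card [LHS]big_mkcond [RHS]big_mkcond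
      /=.
    apply: eq_bigr => c _; rewrite [c \in [set _ in _ | _]]inE -scalemxAr.
    by case: (c \in kappa) => //=; case: eqP.
  rewrite exchange_big; apply: eq_bigr => c _;
    rewrite -sum1_card [RHS]big_mkcond /=.
  by apply: eq_bigr => j _; rewrite inE; case: eqP.
apply: eq_bigr => c; rewrite inE => /andP[/eqP c3 _].
rewrite card_transvection_cubic //; last by rewrite detZ c3 mul1r.
by rewrite krylovZ c3 mul1r.
Qed.
End ProjectiveCount.

(** * Mapping matrices over the prime field to the projective group *)

Section BlockEmbedding.
Variables (F E : fieldType) (iota : {rmorphism F -> E}).

Lemma block_embedding k : (3 <= k)%N ->
  exists phi : 'M[F]_3 -> 'M[E]_k,
    [/\ forall A B, phi (A *m B) = phi A *m phi B,
        forall A, \det (phi A) = iota (\det A)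
      & injective phi].
Proof.
move/subnKC=> <-; exists (fun A => block_mx (map_mx iota A) 0 0 1%:M).
split=> [A B|A|A B].
- by rewrite mulmx_block !mul0mx !mulmx0 !addr0 add0r mul1mx map_mxM.
- by rewrite det_ublock det1 mulr1 det_map_mx.
by move/eq_block_mx=> [/map_mx_inj].
Qed.
End BlockEmbedding.

Lemma prime_field_embedding (p m : nat) (E : finFieldType) :
  prime p -> #|E| = (p ^ m)%N -> exists iota : {rmorphism 'F_p -> E}, True.
Proof.
move=> p_prime cardE; have charE := card_finPcharP cardE p_prime.
pose iota (k : 'F_p) : E := k%:R.
have modE n : (n %% (Zp_trunc (pdiv p)).+2)%:R = n%:R :> E.
  by rewrite Fp_cast // (GRing.natr_mod_pchar charE).
have iotaD : zmod_morphism iota.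
  have iotaD a b : iota (a + b) = iota a + iota b.
    by rewrite /iota /= modE natrD.
  by move=> a b; rewrite -[in RHS](subrK b a) [in RHS]iotaD addrK.
have iotaM : monoid_morphism iota.
  by split=> [|a b]; rewrite /iota /= modE // natrM.
by exists (HB.pack iota (GRing.isZmodMorphism.Build _ _ iota iotaD)
  (GRing.isMonoidMorphism.Build _ _ iota iotaM) : {rmorphism 'F_p -> E}).
Qed.

(** Commuting with one transvection and with the cyclic permutation matrix already forces a
    scalar. *)
Lemma centralizer_sl3 (F : fieldType) (C : 'M[F]_3) :
  (forall T, \det T = 1 -> C *m T = T *m C) -> exists c, C = c%:M.
Proof.
move=> comC; have := comC _ (det_transvection (1, 0)).
have := comC _ (det_cycle_mx F); move/matrixP=> Ec /matrixP Et.
exists (C o0 o0).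
move: (Ec o0 o0) (Ec o0 o1) (Ec o0 o2) (Ec o1 o0) (Ec o1 o1) (Ec o1 o2)
  (Ec o2 o0) (Ec o2 o1) (Ec o2 o2) (Et o0 o0) (Et o0 o1) (Et o0 o2) (Et o1 o1)
    (Et o2 o1).
rewrite !mulmx3E !mxE /= !(mulr0, mulr1, mul0r, mul1r, addr0, add0r).
move=> e00 e01 e02 e10 e11 e12 e20 e21 e22 t00 t01 t02 t11 t21.
have addr_eq (x y : F) : x = x + y -> y = 0.
  by move/eqP; rewrite -{1}[x]addr0 (inj_eq (addrI x)) => /eqP.
have c10 := addr_eq _ _ t00; have c12 := addr_eq _ _ t02.
have c20 : C o2 o0 = 0 by apply: (addr_eq (C o2 o1)); rewrite addrC t21.
have c01 : C o0 o1 = 0 by rewrite e00.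
have c02 : C o0 o2 = 0 by rewrite -e12.
have c21 : C o2 o1 = 0 by rewrite e20.
by apply/matrixP; apply: ord3_cases; apply: ord3_cases;
   rewrite !mxE /= ?mulr1n ?mulr0n.
Qed.

Section PSL3.
Variables (N : nat) (F E : finFieldType) (iota : {rmorphism F -> E}).
Hypothesis N_ge3 : (3 <= N)%N.

(** A matrix is completed by an identity block and reduced modulo the center. If [C] of determinant
    1 becomes trivial, its block image is central, so by injectivity [C] commutes with all matrices
    of determinant 1. *)
Lemma sl3_to_psl : exists Phi : 'M[F]_3 -> PSL N E,
  (forall A B, \det A = 1 -> \det B = 1 -> Phi (A *m B) = (Phi A * Phi B)%g) /\
  (forall A B, \det A = 1 -> \det B = 1 -> Phi A = Phi B -> exists c,
    A = c *: B).
Proof.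
(* The elements of ['GL_N[E]] are matrices of size [N.-1.+1]. *)
have [|phi [phiM det_phi phi_inj]] := @block_embedding _ _ iota N.-1.+1.
  by case: N N_ge3.
(* The default [1] is taken only when [phi A] is not invertible, never for determinant 1. *)
pose gl A : {'GL_N[E]} := @insubd _ _ {'GL_N[E]} 1%g (phi A).
have glE A : \det A = 1 -> GLval (gl A) = phi A.
  move=> dA; rewrite /gl val_insubd.
  by rewrite [_ \is a _]unitmxE det_phi dA rmorph1 unitr1.
have gl_SL A : \det A = 1 -> gl A \in SL_group N E.
  by move=> dA; rewrite inE glE // det_phi dA rmorph1.
have glM A B : \det A = 1 -> \det B = 1 -> gl (A *m B) = (gl A * gl B)%g.
  move=> dA dB; apply: val_inj.
  have : GLval (gl (A *m B)) = GLval (gl A * gl B)%g; last by [].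
  by rewrite GL_MxE !glE ?phiM // det_mulmx dA dB mulr1.
pose Z := 'Z(SL_group N E)%G.
have nZ A : \det A = 1 -> (gl A \in 'N(Z))%g.
  by move=> dA; apply: (subsetP (normal_norm (center_normal _))); apply: gl_SL.
pose Phi A : PSL N E := subg (SL_group N E / Z)%G (coset Z (gl A)).
have PhiM A B : \det A = 1 -> \det B = 1 -> Phi (A *m B) = (Phi A * Phi B)%g.
  move=> dA dB; rewrite /Phi glM // morphM ?nZ // subgM //.
    by apply: mem_quotient; apply: gl_SL.
  by apply: mem_quotient; apply: gl_SL.
exists Phi; split=> // A B dA dB AB.
have uB : B \in unitmx by rewrite unitmxE dB unitr1.
pose C := A *m invmx B.
have dC : \det C = 1 by rewrite det_mulmx det_inv dA dB invr1 mulr1.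
have PhiC : Phi C = 1%g.
  by apply: (mulIg (Phi B)); rewrite -PhiM // mulmxKV // mul1g.
have gC : gl C \in Z.
  apply: coset_idr; first exact: nZ.
  have := congr1 sgval PhiC; rewrite subgK //.
  by apply: mem_quotient; apply: gl_SL.
have [c Cc] : exists c, C = c%:M.
  apply: centralizer_sl3 => T dT; apply: phi_inj.
  rewrite (phiM C T) (phiM T C) -(glE C dC) -(glE T dT).
  rewrite -!GL_MxE; congr (GLval _).
  by have /centerP[_ cC] := gC; apply: cC (gl_SL T dT).
by exists c; rewrite -mul_scalar_mx -Cc mulmxKV.
Qed.
End PSL3.

(** * Arithmetic of the final count and conclusion *)

Lemma coprime_count (p k : nat) : prime p -> (k + p.-1 = p ^ 2)%N ->
  ~~ (p ^ 2 %| (p ^ 3).-1 * ((p ^ 3).-1 * k))%N.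
Proof.
move=> p_prime kE; have p_gt0 := prime_gt0 p_prime.
(* Already [p] fails to divide the product: [p ^ 3 - 1] and [k = p ^ 2 - p + 1] are both prime to
   [p]. *)
apply/negP=> /(dvdn_trans (dvdn_exp (isT : (0 < 2)%N) (dvdnn p))).
have p3 : ~~ (p %| (p ^ 3).-1)%N.
  apply/negP=> p_dvd; have := dvdn_exp (isT : (0 < 3)%N) (dvdnn p).
  rewrite -[X in (_ %| X)%N]prednK ?expn_gt0 ?p_gt0 // -addn1 dvdn_addr //.
  by rewrite dvdn1 => /eqP p1; rewrite p1 in p_prime.
rewrite !Euclid_dvdM // (negbTE p3) /= => p_dvd.
have := dvdn_exp (isT : (0 < 2)%N) (dvdnn p).
rewrite -kE dvdn_addr // => /dvdn_leq; rewrite -[X in (_ < X)%N]subn1 subn_gt0.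
by rewrite prime_gt1 // => /(_ isT); rewrite leqNgt prednK ?leqnn.
Qed.

Local Close Scope ring_scope.

Theorem theorem7p2 (K : fieldExtType rat) (n p m : nat) (Fq : finFieldType)
    (n_ge1 : 1 <= n) (p_prime : prime p) (m_ge1 : 1 <= m)
    (card_Fq : #|Fq| = p ^ m)
    (K_root : exists z : K, (p.-primitive_root z)%R) :
  exists (M : {group PSL (2 * n + 1) Fq})
         (w : chargroup K (subg_of M) -> chargroup K (subg_of M) -> K),
    [/\ abelian M,
        split_algebra (group_algebra K (subg_of M)),
        normalized_2cocycle w
      & ~ admits_hopf_order (ring_of_integers K) (twisted_group_algebra w)].
Proof.
have [zeta prim_zeta] := K_root.
have [iota _] := prime_field_embedding p_prime card_Fq.
have N_ge3 : 3 <= 2 * n + 1 by rewrite addn1 ltnS leq_pmulr.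
have [Phi [PhiM Phi_scalar]] := sl3_to_psl iota N_ge3.
pose mu := Phi \o @transvection 'F_p.
have muD i j : mu (i + j)%R = (mu i * mu j)%g.
  rewrite /mu /= -PhiM ?det_transvection //; congr Phi.
  by apply/matrixP; apply: ord3_cases; apply: ord3_cases;
    rewrite mulmx3E !mxE /=; ring.
have mu_inj : injective mu.
  move=> i j /(Phi_scalar _ _ (det_transvection i) (det_transvection j))[c
    /matrixP E].
  (* The last diagonal entry forces the scalar [c] to be 1. *)
  have := E o2 o2; rewrite !mxE /= mulr1 => c1.
  have := E o0 o1; have := E o0 o2; rewrite !mxE /= -c1 !mul1r.
  by case: i j {E} => [? ?] [? ?] /= -> ->.
have pK := prime_natr_neq0 K p_prime.
exists (mu_group muD), (mu_cocycle p_prime prim_zeta (muD := muD) mu_inj);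
  split.
- exact: abelian_mu.
- exact: (split_mu p_prime prim_zeta pK).
- exact: mu_cocycle_normalized.
move=> hopf_order.
have [s [t rootless]] := exists_rootless_cubic 'F_p.
pose L := Phi_group PhiM.
have muL i : mu i \in L by apply/mem_Phi/det_transvection.
have cycL : Phi (cycle_mx 'F_p) \in L by apply/mem_Phi/det_cycle_mx.
have conjL d : Phi (companion_conj s t d) \in L by
  apply/mem_Phi/det_companion_conj.
have := dvdn_conjugate_count hopf_order muL conjL cycL cycL.
have dC := det_cycle_mx 'F_p.
(* The permutation matrix has [e0] as a cyclic vector, so the first count is [p ^ 3 - 1]. *)
have kC : krylov (cycle_mx 'F_p) != 0%R.
  by rewrite (_ : krylov _ = -1)%R ?oppr_eq0 ?oner_eq0 // /krylov !mxE /=; ring.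
rewrite (card_Phi_transvection PhiM Phi_scalar rootless dC) kC muln1.
(* For fixed [k], the sum over [d] and [j] is the transvection count at [g u_k g], with [g] the
   cyclic matrix and [u_k] the transvection of [k]. It is [p ^ 3 - 1] or [0], so the total counts
   the [k] with nonzero [krylov]. *)
have -> : (\sum_d \sum_j \sum_k #|[set l in L |
      (l * Phi (companion_conj s t d) * l^-1)%g ==
      (mu j * Phi (cycle_mx _) * mu k * Phi (cycle_mx _))%g]|)%N =
    ((p ^ 3).-1 * #|[set x : 'F_p * 'F_p |
       krylov (cycle_mx _ *m transvection x *m cycle_mx _)%R != 0%R]|)%N.
  rewrite [RHS]mulnC -sum_nat_const [RHS]big_mkcond /=.
  under eq_bigr do rewrite exchange_big /=.
  rewrite exchange_big; apply: eq_bigr => k _; rewrite inE.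
  have dCk : (\det (cycle_mx 'F_p *m transvection k *m cycle_mx 'F_p) = 1)%R.
    by rewrite !det_mulmx dC det_transvection !mulr1.
  have := card_Phi_transvection PhiM Phi_scalar rootless dCk.
  rewrite card_Fp // => E; apply: etrans (etrans E _); last first.
    by case: eqP; rewrite ?muln0 ?muln1.
  apply: eq_bigr => d _; apply: eq_bigr => j _.
  have dk : (\det (cycle_mx 'F_p *m transvection k) = 1)%R.
    by rewrite det_mulmx dC det_transvection mulr1.
  by rewrite (PhiM _ _ dk dC) (PhiM _ _ dC (det_transvection k)) !mulgA.
rewrite card_Fp //; apply/negP/coprime_count => //.
by have := card_krylov_cycle 'F_p; rewrite card_Fp.
Qed.
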